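(* Let $n\geq 2$ be a fixed integer, and let $p=p(k)\in(0,1)$ be such that $$(2n-1)^{2k/3}\,p=\Omega_{k}(k^{6}).$$ For each $k\ge 3$ let $\Gamma_{k}\sim\Gamma_{p}(n,k,p)$. Then $$\lim_{k\rightarrow \infty }\mathbb{P}(\Gamma_{k}\text{ has Property }(T))=1.$$
   Context: Model $\Gamma_p(n,k,p)$: let $A_n=\{a_1,\dots,a_n\}$, $F_n$ the free group on $A_n$, and $\mathcal{C}(n,k)$ the set of cyclically reduced words of length $k$ in $F_n$. The random group is $\Gamma=\langle A_n\mid R\rangle$, where $R$ is obtained by including each word of $\mathcal{C}(n,k)$ independently with probability $p$. Asymptotic notation: $f=\Omega_k(g)$ means $g=o(f)$ as $k\to\infty$, i.e. $g(k)/f(k)\to 0$. Property (T): a finitely generated group $\Gamma$ with finite generating set $S$ has Property (T) if every unitary representation $\pi$ of $\Gamma$ on a Hilbert space $\mathcal{H}$ with almost-invariant vectors (for every $\epsilon>0$ there is a non-zero $u\in\mathcal{H}$ with $\|\pi(s)u-u\|<\epsilon\|u\|$ for all $s\in S$) has a non-zero invariant vector. *)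

(* Defs.v *)
From HB Require Import structures.
From mathcomp Require Import all_boot all_order all_algebra.
From mathcomp Require Import all_classical all_reals all_analysis.
From mathcomp Require Import complex.

Set Implicit Arguments.
Unset Strict Implicit.
Unset Printing Implicit Defensive.
Import Order.TTheory GRing.Theory Num.Theory numFieldNormedType.Exports.

Local Open Scope classical_set_scope.

Section Subgroups.
Local Open Scope group_scope.
Variable G : groupType.
Implicit Types (A N : set G).

Definition is_subgroup N : Prop :=
  [/\ N 1, forall x y, N x -> N y -> N (x * y) & forall x, N x -> N x^-1].

Definition is_normal_subgroup N : Prop :=
  is_subgroup N /\ forall x y, N x -> N (x ^ y).

Definition generated_subgroup A : set G := smallest is_subgroup A.

Definition normal_closure A : set G := smallest is_normal_subgroup A.

Lemma normal_closure_normal A : is_normal_subgroup (normal_closure A).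
Proof.
split; first split.
- by move=> N [[[N1 _ _] _] _].
- move=> x y Ax Ay N NA; have [[[_ NM _] _] _] := NA.
  exact: NM (Ax _ NA) (Ay _ NA).
- move=> x Ax N NA; have [[[_ _ NV] _] _] := NA; exact: NV (Ax _ NA).
- move=> x y Ax N NA; have [[_ NJ] _] := NA; exact: NJ (Ax _ NA).
Qed.

Definition coset_rel A : rel G := fun x y => `[< normal_closure A (x^-1 * y) >].

Lemma coset_rel_is_equiv A : equiv_class_of (coset_rel A).
Proof.
have [[N1 NM NV] _] := normal_closure_normal A.
split=> [x|x y|y x z].
- by apply/asboolP; rewrite mulVg.
- by apply/asboolP/asboolP => /NV; rewrite invgM invgK.
- move=> /asboolP xy /asboolP yz; apply/asboolP.
  by have := NM _ _ xy yz; rewrite mulgA mulgK.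
Qed.

Canonical coset_equiv A := EquivRelPack (coset_rel_is_equiv A).

End Subgroups.

(* [quotient_group A] is the quotient of G by the normal closure of A. *)
Definition quotient_group (G : groupType) (A : set G) : Type :=
  {eq_quot (coset_equiv A)}%qT.

Section QuotientGroup.
Local Open Scope group_scope.
Local Open Scope quotient_scope.
Variables (G : groupType) (A : set G).

HB.instance Definition _ :=
  EqQuotient.copy (quotient_group A) {eq_quot (coset_equiv A)}.
HB.instance Definition _ :=
  Choice.copy (quotient_group A) {eq_quot (coset_equiv A)}.

Local Notation Q := (quotient_group A).

Let one : Q := \pi_Q 1.
Let inv (a : Q) : Q := \pi_Q (repr a)^-1.
Let mul (a b : Q) : Q := \pi_Q (repr a * repr b).

Let piP x y : (\pi_Q x = \pi_Q y) <-> normal_closure A (x^-1 * y).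
Proof. by split=> [/eqquotP/asboolP|h]; last exact/eqquotP/asboolP. Qed.

Let pi_inv x : inv (\pi_Q x) = \pi_Q x^-1.
Proof.
have [[_ _ NV] NJ] := normal_closure_normal A.
apply/piP; rewrite invgK.
have /piP/NV/(NJ _ x^-1) : \pi_Q (repr (\pi_Q x)) = \pi_Q x by rewrite reprK.
by rewrite /conjg invgM !invgK !mulgA mulgV mul1g.
Qed.

Let pi_mul x y : mul (\pi_Q x) (\pi_Q y) = \pi_Q (x * y).
Proof.
have [[_ NM _] NJ] := normal_closure_normal A.
apply/piP; set x' := repr _; set y' := repr _.
have /piP/(NJ _ y') hx : \pi_Q x' = \pi_Q x by rewrite reprK.
have /piP/(NM _ _ hx) : \pi_Q y' = \pi_Q y by rewrite reprK.
by rewrite /conjg !mulgA mulgK invgM.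
Qed.

Let mulA : associative mul.
Proof.
by move=> a b c; rewrite -[a]reprK -[b]reprK -[c]reprK !pi_mul mulgA !reprK.
Qed.

Let mul1 : left_id one mul.
Proof. by move=> a; rewrite -[a]reprK pi_mul mul1g. Qed.

Let mulr1 : right_id one mul.
Proof. by move=> a; rewrite -[a]reprK pi_mul mulg1. Qed.

Let mulV : left_inverse one inv mul.
Proof. by move=> a; rewrite -[a]reprK pi_inv pi_mul mulVg. Qed.

Let mulrV : right_inverse one inv mul.
Proof. by move=> a; rewrite -[a]reprK pi_inv pi_mul mulgV. Qed.

HB.instance Definition _ := isGroup.Build Q mulA mul1 mulr1 mulV mulrV.

Lemma piM : {morph \pi_Q : x y / x * y}.
Proof. by move=> x y; rewrite -pi_mul. Qed.

Lemma pi1_eq x : (\pi_Q x = 1) <-> normal_closure A x.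
Proof.
have [[_ _ NV] _] := normal_closure_normal A.
rewrite (_ : 1 = \pi_Q 1)// piP mulg1; split=> /NV //.
by rewrite invgK.
Qed.

End QuotientGroup.

(* The letter (i, false) stands for the generator a_i, (i, true) for its      *)
(* inverse.                                                                   *)
Definition letter (n : nat) : Type := ('I_n * bool)%type.
HB.instance Definition _ n := Finite.copy (letter n) ('I_n * bool)%type.

Definition inv_letter n (x : letter n) : letter n := (x.1, ~~ x.2).

Lemma inv_letterK n : involutive (@inv_letter n).
Proof. by case=> i b; rewrite /inv_letter /= negbK. Qed.

Definition no_cancel n : rel (letter n) := fun x y => y != inv_letter x.

Definition reduced n (w : seq (letter n)) : bool := sorted (@no_cancel n) w.

(* [cycle] also compares the last letter with the first one. *)
Definition cyclically_reduced n (w : seq (letter n)) : bool :=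
  cycle (@no_cancel n) w.

Lemma cyclically_reduced_reduced n (w : seq (letter n)) :
  cyclically_reduced w -> reduced w.
Proof.
by case: w => // x w; rewrite /cyclically_reduced /= rcons_path => /andP[].
Qed.

(* The free group F_n, realised as the set of reduced words. *)
Record free_group (n : nat) : Type :=
  FreeGroup { word_of :> seq (letter n); _ : reduced word_of }.

HB.instance Definition _ n := [isSub for @word_of n].
HB.instance Definition _ n := [Countable of free_group n by <:].

Section FreeGroup.
Variable n : nat.
Implicit Types (x y : letter n) (u v w : seq (letter n)).

Definition push x w : seq (letter n) :=
  if w is y :: w' then if y == inv_letter x then w' else x :: w else [:: x].

Definition pushs u w : seq (letter n) := foldr push w u.

Definition reduce w : seq (letter n) := pushs w [::].

Lemma push_reduced x w : reduced w -> reduced (push x w).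
Proof.
case: w => //= y w yw; case: eqP => [_|/eqP yx]; first exact: path_sorted yw.
by rewrite /= yw andbT.
Qed.

Lemma pushs_reduced u w : reduced w -> reduced (pushs u w).
Proof. by move=> rw; elim: u => //= x u; apply: push_reduced. Qed.

Lemma reduce_reduced w : reduced (reduce w).
Proof. exact: pushs_reduced. Qed.

Lemma reduce_id w : reduced w -> reduce w = w.
Proof.
elim: w => //= x w IH xw; rewrite IH; last exact: path_sorted xw.
case: w xw {IH} => //= y w /andP[/negbTE xy _].
by rewrite xy.
Qed.

Lemma pushK x w : reduced w -> push (inv_letter x) (push x w) = w.
Proof.
case: w => [_|y w] /=; first by rewrite inv_letterK eqxx.
case: eqP => [-> | _]; last by rewrite /= inv_letterK eqxx.
case: w => //= z w /andP[/negbTE zx _].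
by rewrite zx.
Qed.

Lemma pushVK x w : reduced w -> push x (push (inv_letter x) w) = w.
Proof. by move=> rw; rewrite -{1}[x]inv_letterK pushK. Qed.

Lemma pushs_push x u w : reduced w -> pushs (push x u) w = push x (pushs u w).
Proof.
move=> rw; case: u => //= y u; case: eqP => [->|//].
by rewrite pushVK // pushs_reduced.
Qed.

Lemma pushs_pushs u v w : reduced w -> pushs (pushs u v) w = pushs u (pushs v w).
Proof. by move=> rw; elim: u => //= x u IH; rewrite pushs_push // IH. Qed.

Definition fg_mul (a b : free_group n) : free_group n :=
  FreeGroup (reduce_reduced (a ++ b)).

Definition fg_one : free_group n := @FreeGroup n [::] isT.

Definition fg_inv (a : free_group n) : free_group n :=
  FreeGroup (reduce_reduced (rev (map (@inv_letter n) a))).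

Let redP (a : free_group n) : reduced a. Proof. by case: a. Qed.

Let word_inj : injective (@word_of n). Proof. exact: val_inj. Qed.

Let fg_mulE (a b : free_group n) : fg_mul a b = pushs a b :> seq _.
Proof.
have := reduce_id (redP b); rewrite /reduce /pushs => rb.
by rewrite /= /reduce /pushs foldr_cat rb.
Qed.

Lemma fg_mulA : associative fg_mul.
Proof. by move=> a b c; apply: word_inj; rewrite !fg_mulE pushs_pushs. Qed.

Lemma fg_mul1 : left_id fg_one fg_mul.
Proof. by move=> a; apply: word_inj; rewrite fg_mulE. Qed.

Lemma fg_mulr1 : right_id fg_one fg_mul.
Proof. by move=> a; apply: word_inj; rewrite /= cats0 reduce_id. Qed.

Let pushsV u w : reduced w ->
  pushs (rev (map (@inv_letter n) u)) (pushs u w) = w.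
Proof.
elim: u w => //= x u IH w rw.
rewrite rev_cons -cats1 [LHS]foldr_cat /= pushK; first exact: IH.
exact: pushs_reduced.
Qed.

Lemma fg_mulV : left_inverse fg_one fg_inv fg_mul.
Proof.
move=> a; apply: word_inj; rewrite fg_mulE /= [LHS]pushs_pushs //.
by rewrite -{2}(reduce_id (redP a)) pushsV.
Qed.

Lemma fg_mulrV : right_inverse fg_one fg_inv fg_mul.
Proof.
move=> a; rewrite -[LHS]fg_mul1 -{1}(fg_mulV (fg_inv a)).
by rewrite -fg_mulA [X in fg_mul _ X]fg_mulA fg_mulV fg_mul1 fg_mulV.
Qed.

HB.instance Definition _ :=
  isGroup.Build (free_group n) fg_mulA fg_mul1 fg_mulr1 fg_mulV fg_mulrV.

End FreeGroup.

Section RandomGroup.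
Variables n k : nat.

Definition cyc_word : Type :=
  {w : k.-tuple (letter n) | cyclically_reduced w}.
HB.instance Definition _ := Finite.on cyc_word.

Definition free_of_cyc (w : cyc_word) : free_group n :=
  FreeGroup (cyclically_reduced_reduced (valP w)).

Definition presented_group (rels : {set cyc_word}) : groupType :=
  quotient_group [set free_of_cyc w | w in [set` rels]].

Local Open Scope ring_scope.
Variables (R : realType) (p : R).

(* Each word is a relator independently with probability p. *)
Definition relators_pmf (rels : {set cyc_word}) : R :=
  \prod_(w : cyc_word) bernoulli_pmf p (w \in rels).

Lemma sum_relators_pmf : \sum_(rels : {set cyc_word}) relators_pmf rels = 1.
Proof.
rewrite /relators_pmf /bernoulli_pmf.
rewrite -(@bigA_distr _ _ _ _ _ cyc_word (fun=> p) (fun=> 1 - p)).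
by apply: big1 => w _; rewrite /= addrC subrK.
Qed.

Definition random_group_pr (E : groupType -> Prop) : R :=
  \sum_(rels : {set cyc_word} | `[< E (presented_group rels) >])
    relators_pmf rels.

End RandomGroup.

Section PropertyT.
Local Open Scope ring_scope.
Local Open Scope complex_scope.
Variable R : realType.

Record hilbertSpace : Type := HilbertSpace {
  hilbert_sort :> completeNormedModType R[i];
  inner : {dot hilbert_sort for Num.conj};
  inner_norm : forall u, inner u u = `|u| ^+ 2 }.

(* Each [rep_fun g] is invertible, so an isometry is unitary. *)
Record unitary_rep (G : groupType) (H : hilbertSpace) : Type := UnitaryRep {
  rep_fun :> G -> {linear H -> H};
  rep_one : forall u, rep_fun 1%g u = u;
  rep_mul : forall g h u, rep_fun (g * h)%g u = rep_fun g (rep_fun h u);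
  rep_unitary : forall g u v,
    inner H (rep_fun g u) (rep_fun g v) = inner H u v }.

Definition almost_invariant_vectors (G : groupType) (S : seq G)
    (H : hilbertSpace) (pi : unitary_rep G H) : Prop :=
  forall eps : R, 0 < eps -> exists u : H,
    u != 0 /\ forall s, s \in S -> `|pi s u - u| < eps%:C * `|u|.

Definition invariant_vector (G : groupType)
    (H : hilbertSpace) (pi : unitary_rep G H) : Prop :=
  exists u : H, u != 0 /\ forall g, pi g u = u.

(* The condition does not depend on the finite generating set S. *)
Definition property_T (G : groupType) : Prop :=
  exists S : seq G, generated_subgroup [set` S] = setT /\
    forall (H : hilbertSpace) (pi : unitary_rep G H),
      almost_invariant_vectors S pi -> invariant_vector pi.

End PropertyT.

(* f = Omega(g) in the sense g = o(f). *)
Definition is_Omega (R : realType) (f g : nat -> R) : Prop :=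
  (fun k => g k / f k)%R @ \oo --> (0 : R)%R.

(* Main.v *)
Require Import Defs.
From HB Require Import structures.
From mathcomp Require Import all_boot all_order all_algebra.
From mathcomp Require Import all_classical all_reals all_analysis.
From mathcomp Require Import complex.
From mathcomp Require Import ring lra zify.

(** Relators of one special shape are enough. Fix a letter [a] and call
    blocks the words [x] of length [l], about [k / 3], such that [a x a] is
    reduced; the special relators are [x a y a z a ^ (1 + m)] with blocks
    [x], [y], [z]. They are cyclically reduced whatever the blocks are, so
    the chosen relators form a binomial random subset of the full cube of
    triples of blocks, and [m] in [{0, 1, 2}] absorbs the residue of [k]
    modulo 3. There are [N >= (2n - 1) ^ (l - 1)] blocks, and each one lies,
    in each position, in [d = p N ^ 2] chosen triples on average; the
    hypothesis on [p] says that [d] eventually exceeds [k ^ 6].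

    Geometry. Let a unitary representation be given, with its action [act].
    A relator is a triangle whose three sides are group elements of product
    [1], and to a triple of vectors [u_0, u_1, u_2] one associates the
    energy, the sum over the chosen relators [e] of the three terms [|u_i -
    g_i(e_i) u_(i+1)| ^ 2]. Garland's argument bounds one of these three
    terms below by the other two: the third side of a triangle is the
    difference of two functions on the link of the opposite vertex, and the
    link is nearly a complete bipartite graph, on which differences of
    functions are controlled by the functions themselves up to their means
    ([link_gap], [vertex_gap]). Summing the three bounds gives [c <L u, u>
    <= |L u| ^ 2] for the operator [L] representing the energy
    ([garland_gap]). With such a gap gradient descent converges
    geometrically, so that near a triple of small energy there is one of
    zero energy ([zero_energy_near]). Almost invariant vectors have small
    energy, and a triple of zero energy is so rigid that it yields an
    invariant vector ([letters_swap], [quasirandom_property_T]).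

    Probability. What the geometry needs from the random set of triples is
    one inequality ([quasirandom]): replacing the indicator of the set by
    its mean [p] in the sum of [|f_0(e_0) + f_1(e_1) + f_2(e_2)| ^ 2] costs
    at most [d / 4] times the sum of the squared norms of the [f_i]. It
    contains both the concentration of the degrees and the spectral gap of
    the links, and it is a bound on the operator norm of one random
    symmetric matrix, a sum of independent centred matrices of rank one.
    That norm is bounded by the trace method: the expected trace of the
    [L]-th power, [L] a power of two between [k] and [2 k], is a sum over
    walks of [L] edges; only walks that use each of their edges at least
    twice contribute, and repeating an edge leaves few choices
    ([expect_noise_pow_le]). Since [d] is much larger than [L], the bound
    wins over the exponential number of vertices, and the probability that
    Property (T) fails is at most [3 / 2 ^ k] for large [k]
    ([property_T_pr_ge]). *)

Set Implicit Arguments.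
Unset Strict Implicit.
Unset Printing Implicit Defensive.
Import Order.TTheory GRing.Theory Num.Theory numFieldNormedType.Exports.

Local Open Scope classical_set_scope.
Local Open Scope ring_scope.

(** * Expectations and moments of a random symmetric matrix *)

Fixpoint mxpow (R : realType) (V : finType) (B : V -> V -> R) (m : nat)
    (v u : V) : R :=
  if m is m'.+1 then \sum_w B v w * mxpow B m' w u else (v == u)%:R.

Section MatrixPowers.
Variables (R : realType) (V : finType) (B : V -> V -> R).

Lemma mxpowD m1 m2 v u :
  mxpow B (m1 + m2) v u = \sum_w mxpow B m1 v w * mxpow B m2 w u.
Proof.
elim: m1 v => [|m IH] v /=.
  rewrite (bigD1 v) //= eqxx mul1r big1 ?addr0 // => w /negbTE wv.
  by rewrite eq_sym wv mul0r.
under eq_bigr do rewrite IH mulr_sumr.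
rewrite exchange_big; apply: eq_bigr => w _ /=; rewrite mulr_suml.
by apply: eq_bigr => x _; rewrite mulrA.
Qed.

Hypothesis B_sym : forall v u, B v u = B u v.

Lemma mxpow_sym m v u : mxpow B m v u = mxpow B m u v.
Proof.
elim: m v u => [|m IH] v u; first by rewrite /= eq_sym.
rewrite -[in RHS]addn1 mxpowD /=; apply: eq_bigr => w _.
rewrite IH B_sym mulrC; congr (_ * _); rewrite (bigD1 v) //= eqxx mulr1.
by rewrite big1 ?addr0 // => x /negbTE xv; rewrite xv mulr0.
Qed.

Lemma trace_double m :
  \sum_v mxpow B (m + m) v v = \sum_v \sum_w mxpow B m v w ^+ 2.
Proof.
apply: eq_bigr => v _; rewrite mxpowD; apply: eq_bigr => w _.
by rewrite expr2 (mxpow_sym m w v).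
Qed.

End MatrixPowers.

Section Moments.
Variables (R : realType) (n k : nat) (p : R).
Hypothesis p01 : 0 <= p <= 1.

Definition expect (F : {set cyc_word n k} -> R) : R :=
  \sum_(rels : {set cyc_word n k}) relators_pmf p rels * F rels.

Lemma relators_pmf_ge0 (rels : {set cyc_word n k}) : 0 <= relators_pmf p rels.
Proof.
apply: prodr_ge0 => w _; rewrite /bernoulli_pmf.
by case: ifP => _; move: p01 => /andP[]; rewrite // subr_ge0.
Qed.

Lemma eq_expect F G : F =1 G -> expect F = expect G.
Proof. by move=> FG; apply: eq_bigr => rels _; rewrite FG. Qed.

Lemma expectZ c F : expect (fun rels => c * F rels) = c * expect F.
Proof. by rewrite /expect mulr_sumr; apply: eq_bigr => rels _; rewrite mulrCA. Qed.

Lemma expect_sum (I : finType) (F : I -> {set cyc_word n k} -> R) :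
  expect (fun rels => \sum_i F i rels) = \sum_i expect (F i).
Proof.
by rewrite /expect; under eq_bigr do rewrite mulr_sumr; rewrite exchange_big.
Qed.

Lemma expect_prod (G : cyc_word n k -> bool -> R) :
  expect (fun rels => \prod_w G w (w \in rels)) =
  \prod_w (p * G w true + (1 - p) * G w false).
Proof.
rewrite (@bigA_distr _ _ _ _ _ (cyc_word n k) (fun w => p * G w true)
  (fun w => (1 - p) * G w false)).
apply: eq_bigr => rels _; rewrite /relators_pmf -big_split; apply: eq_bigr => w _ /=.
by rewrite /bernoulli_pmf; case: (w \in rels).
Qed.

Definition dev (w : cyc_word n k) (rels : {set cyc_word n k}) : R :=
  (w \in rels)%:R - p.

Lemma central_moment_le (m : nat) :
  `|p * (1 - p) ^+ m + (1 - p) * (0 - p) ^+ m|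
  <= if m is 0 then 1 else if m is 1 then 0 else p.
Proof.
case/andP: p01 => p0 p1.
case: m => [|[|m]].
- by rewrite !expr0 !mulr1 addrC subrK normr1.
- by rewrite !expr1 sub0r mulrN mulrC subrr normr0.
have q0 : 0 <= 1 - p by rewrite subr_ge0.
apply: le_trans (ler_normD _ _) _.
have -> : `|p * (1 - p) ^+ m.+2| = p * (1 - p) ^+ m.+2.
  by rewrite ger0_norm // mulr_ge0 // exprn_ge0.
have -> : `|(1 - p) * (0 - p) ^+ m.+2| = (1 - p) * p ^+ m.+2.
  by rewrite normrM ger0_norm // normrX sub0r normrN ger0_norm.
have h1 : (1 - p) ^+ m.+2 <= (1 - p) * (1 - p).
  by rewrite exprS ler_wpM2l // exprS ler_piMr // exprn_ile1 // gerBl.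
have h2 : p ^+ m.+2 <= p * p.
  by rewrite exprS ler_wpM2l // exprS ler_piMr // exprn_ile1.
have := ler_wpM2l p0 h1; have := ler_wpM2l q0 h2; nra.
Qed.

Lemma dev_prod (S : seq (cyc_word n k)) rels :
  \prod_(w <- S) dev w rels = \prod_w dev w rels ^+ count_mem w S.
Proof.
elim: S => [|w S IH]; first by rewrite big_nil big1 // => w _.
rewrite big_cons IH (bigD1 w) //= [in RHS](bigD1 w) //= eqxx mulrA -exprS.
congr (_ * _); apply: eq_bigr => v vw.
by rewrite eq_sym (negbTE vw).
Qed.

(** A word that occurs exactly once in the list makes the expectation vanish, so
    only lists in which every word is repeated contribute, and these have at
    most half as many distinct words as entries.  The free parameter [r >= 1]
    turns this constraint into a weight that is multiplicative in the list, so
    that a sum over lists can later be bounded one entry at a time. *)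
Lemma expect_dev_prod_le (r : R) (S : seq (cyc_word n k)) : 1 <= r ->
  `|expect (fun rels => \prod_(w <- S) dev w rels)|
  <= r ^+ size S * (p / r ^+ 2) ^+ size (undup S).
Proof.
move=> r1; have r0 : 0 < r by apply: lt_le_trans r1.
case/andP: (p01) => p0 p1.
have rp : 0 <= p / r ^+ 2 by rewrite divr_ge0 // exprn_ge0 // ltW.
under [expect _]eq_bigr do rewrite dev_prod.
rewrite -[X in `|X|]/(expect (fun rels => \prod_w dev w rels ^+ count_mem w S)).
rewrite (expect_prod (fun w b => (b%:R - p) ^+ count_mem w S)) normr_prod.
have [/allP hS|/allPn[w wS]] := boolP (all (fun w => 2 <= count_mem w S)%N S).
  apply: (@le_trans _ _ (\prod_(w in S) p)).
    rewrite [leRHS]big_mkcond; apply: ler_prod => w _; rewrite normr_ge0 /=.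
    apply: le_trans (central_moment_le _) _.
    case: ifP => [/hS|/negbT /count_memPn -> //].
    by case: count => [|[|]].
  rewrite prodr_const (_ : #|[pred w in S]| = size (undup S)); last first.
    by rewrite -(card_uniqP (undup_uniq S)); apply: eq_card => w; rewrite !inE mem_undup.
  have h2 : (2 * size (undup S) <= size S)%N.
    rewrite mulnC -sum1_size big_distrl /= -[leqRHS]sum1_size.
    rewrite -[leqRHS]big_undup_iterop_count [leqLHS]big_seq [leqRHS]big_seq.
    apply: leq_sum => w; rewrite mem_undup => /hS; rewrite mul1n.
    by rewrite Monoid.iteropE iter_addn_0 mul1n.
  rewrite expr_div_n mulrCA -[leLHS]mulr1 ler_wpM2l ?exprn_ge0 //.
  by rewrite -exprM -expfB_cond ?exprn_ege1 // gt_eqF.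
rewrite -has_pred1 has_count in wS *.
move=> h; rewrite (bigD1 w) //= (_ : count_mem w S = 1%N); last first.
  by apply/eqP; rewrite eqn_leq wS andbT leqNgt.
have := central_moment_le 1 => /=; rewrite normr_le0 => /eqP ->.
by rewrite normr0 mul0r mulr_ge0 // exprn_ge0 // ltW.
Qed.

Section RandomMatrix.
Variables (V E : finType) (word : E -> cyc_word n k) (A : E -> V -> V -> R).
Hypothesis word_inj : injective word.
Hypothesis A_ge0 : forall e v u, 0 <= A e v u.

Definition noise (rels : {set cyc_word n k}) (v u : V) : R :=
  \sum_e A e v u * dev (word e) rels.

(** The trace method, with the walk replaced by the list [S] of the edges it has
    used so far.  Expanding one factor of the power appends an edge [e] to [S]:
    either [e] is fresh, which costs a factor [p / r ^+ 2] and has total weight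
    at most [D], or it is already in [S], which leaves a total weight of at most
    [a * L]; hence the two summands of the base of the last power. *)
Lemma expect_noise_pow_le (r D a : R) (L m : nat) (S : seq E) (v u : V) :
  1 <= r -> (forall v, \sum_e \sum_u A e v u <= D) ->
  0 <= a -> (forall e v, \sum_u A e v u <= a) -> (size S + m <= L)%N ->
  `|expect (fun rels => \prod_(e <- S) dev (word e) rels *
                        mxpow (noise rels) m v u)|
  <= r ^+ (size S + m) * (p / r ^+ 2) ^+ size (undup S) *
     (D * (p / r ^+ 2) + a * L%:R) ^+ m.
Proof.
move=> r1 AD a0 Aa; have r0 : 0 < r by apply: lt_le_trans r1.
case/andP: (p01) => p0 p1.
set s := p / r ^+ 2; set Y := D * s + a * L%:R.
have s0 : 0 <= s by rewrite divr_ge0 // exprn_ge0 // ltW.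
have D0 : 0 <= D by apply: le_trans (AD v); do 2 apply: sumr_ge0 => *.
have Y0 : 0 <= Y by rewrite addr_ge0 // mulr_ge0.
elim: m S v => [|m IH] S v szS.
  rewrite expr0 mulr1 addn0 (eq_expect (G := fun rels => (v == u)%:R *
    \prod_(w <- map word S) dev w rels)); last first.
    by move=> rels; rewrite big_map mulrC.
  rewrite expectZ normrM -[leRHS]mul1r; apply: ler_pM => //.
    by case: eqP; rewrite ?normr1 ?normr0.
  have := expect_dev_prod_le (map word S) r1.
  by rewrite size_map undup_map_inj // size_map.
have -> : expect (fun rels => \prod_(e <- S) dev (word e) rels *
                              mxpow (noise rels) m.+1 v u)
  = \sum_e \sum_w A e v w * expect (fun rels =>
      \prod_(f <- e :: S) dev (word f) rels * mxpow (noise rels) m w u).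
  under [RHS]eq_bigr do under eq_bigr do rewrite -expectZ.
  under [RHS]eq_bigr do rewrite -expect_sum.
  rewrite -expect_sum; apply: eq_expect => rels /=.
  rewrite mulr_sumr exchange_big; apply: eq_bigr => w _ /=.
  rewrite mulr_suml mulr_sumr; apply: eq_bigr => e _.
  by rewrite big_cons; ring.
apply: le_trans (ler_norm_sum _ _ _) _.
set Z := r ^+ (size S + m.+1) * s ^+ size (undup S) * Y ^+ m.
have Z0 : 0 <= Z by rewrite !mulr_ge0 // exprn_ge0 // ltW.
apply: (@le_trans _ _ (\sum_e \sum_w A e v w * (Z * (s + (e \in S)%:R)))).
  apply: ler_sum => e _; apply: le_trans (ler_norm_sum _ _ _) _.
  apply: ler_sum => w _; rewrite normrM (ger0_norm (A_ge0 _ _ _)).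
  apply: ler_wpM2l => //; apply: le_trans (IH (e :: S) w _) _.
    by rewrite /= addSnnS.
  rewrite /= addSnnS /Z; case: ifP => eS /=.
    rewrite ler_peMr ?mulr_ge0 ?exprn_ge0 // ?(ltW r0) //.
    by rewrite lerDr.
  by rewrite addr0 exprS le_eqVlt; apply/orP; left; apply/eqP; ring.
under eq_bigr do rewrite -mulr_suml mulrCA.
rewrite -mulr_sumr exprSr mulrA -/Z; apply: ler_wpM2l => //.
under eq_bigr do rewrite mulrDr.
rewrite big_split -mulr_suml; apply: lerD; first exact: ler_wpM2r.
apply: (@le_trans _ _ (\sum_e a * (e \in S)%:R)).
  by apply: ler_sum => e _; apply: ler_wpM2r.
rewrite -mulr_sumr ler_wpM2l // -natr_sum ler_nat.
rewrite (eq_bigr (fun e => if e \in S then 1 else 0)%N); last first.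
  by move=> e _; case: (e \in S).
rewrite -big_mkcond sum1_card; apply: leq_trans (card_size S) _.
by apply: leq_trans szS; rewrite leq_addr.
Qed.

Lemma expect_noise_trace_le (r D a : R) (L : nat) :
  1 <= r -> (forall v, \sum_e \sum_u A e v u <= D) ->
  0 <= a -> (forall e v, \sum_u A e v u <= a) ->
  expect (fun rels => \sum_v mxpow (noise rels) L v v)
  <= #|V|%:R * (r * (D * (p / r ^+ 2) + a * L%:R)) ^+ L.
Proof.
move=> r1 AD a0 Aa; rewrite expect_sum mulr_natl -sumr_const.
apply: ler_sum => v _; apply: le_trans (ler_norm _) _.
have := @expect_noise_pow_le r D a L L [::] v v r1 AD a0 Aa (leqnn L).
rewrite add0n expr0 mulr1 -exprMn; apply: le_trans.
rewrite le_eqVlt; apply/orP; left; apply/eqP; congr (`| _ |).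
by apply: eq_expect => rels; rewrite big_nil mul1r.
Qed.

End RandomMatrix.

(** Markov's inequality, for a property that holds as soon as [F] is small. *)
Lemma random_group_pr_ge (F : {set cyc_word n k} -> R) (t : R)
    (P : groupType -> Prop) :
  0 < t -> (forall rels, 0 <= F rels) ->
  (forall rels, F rels <= t -> P (presented_group rels)) ->
  1 - expect F / t <= random_group_pr n k p P.
Proof.
move=> t0 F0 FP; rewrite lerBlDr -lerBlDl -(sum_relators_pmf n k p).
rewrite (bigID (fun rels => `[< P (presented_group rels) >])) /=.
rewrite -[X in _ - X]/(random_group_pr n k p P) addrAC subrr add0r.
rewrite /expect mulr_suml [leLHS]big_mkcond; apply: ler_sum => rels _.
have pF : 0 <= relators_pmf p rels * F rels / t.
  by rewrite divr_ge0 ?mulr_ge0 ?relators_pmf_ge0 // ltW.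
case: ifP => // /asboolP nP; rewrite -mulrA ler_peMr ?relators_pmf_ge0 //.
by rewrite ler_pdivlMr // mul1r leNgt; apply/negP => /ltW /FP.
Qed.

Lemma random_group_pr_le1 (P : groupType -> Prop) :
  random_group_pr n k p P <= 1.
Proof.
rewrite -(sum_relators_pmf n k p) [leLHS]big_mkcond; apply: ler_sum => rels _.
by case: ifP => // _; apply: relators_pmf_ge0.
Qed.

End Moments.

(** * Real inner products *)

Record is_inner (R : realType) (V : lmodType R) (ip : V -> V -> R) : Prop :=
  IsInner {
    ipDl : forall u v w, ip (u + v) w = ip u w + ip v w;
    ipZl : forall a u v, ip (a *: u) v = a * ip u v;
    ipC : forall u v, ip u v = ip v u;
    ip_ge0 : forall u, 0 <= ip u u }.

Section Inner.
Variables (R : realType) (V : lmodType R) (ip : V -> V -> R).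
Hypothesis ipP : is_inner ip.
Local Notation sqn u := (ip u u).

Lemma ipDr u v w : ip u (v + w) = ip u v + ip u w.
Proof. by rewrite (ipC ipP) (ipDl ipP) !(ipC ipP u). Qed.

Lemma ipZr a u v : ip u (a *: v) = a * ip u v.
Proof. by rewrite (ipC ipP) (ipZl ipP) (ipC ipP u). Qed.

Lemma ipNl u v : ip (- u) v = - ip u v.
Proof. by rewrite -scaleN1r (ipZl ipP) mulN1r. Qed.

Lemma ipNr u v : ip u (- v) = - ip u v.
Proof. by rewrite -scaleN1r ipZr mulN1r. Qed.

Lemma ip0l u : ip 0 u = 0.
Proof. by rewrite -(scale0r 0) (ipZl ipP) mul0r. Qed.

Lemma ip_suml (I : Type) (s : seq I) (P : pred I) (F : I -> V) v :
  ip (\sum_(i <- s | P i) F i) v = \sum_(i <- s | P i) ip (F i) v.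
Proof.
apply: (big_morph (fun u => ip u v)) => [x y|]; first exact: (ipDl ipP).
exact: ip0l.
Qed.

Lemma ip_sumr (I : Type) (s : seq I) (P : pred I) (F : I -> V) v :
  ip v (\sum_(i <- s | P i) F i) = \sum_(i <- s | P i) ip v (F i).
Proof. by rewrite (ipC ipP) ip_suml; apply: eq_bigr => i _; apply: (ipC ipP). Qed.

Lemma sqnD u v : sqn (u + v) = sqn u + 2 * ip u v + sqn v.
Proof. by rewrite (ipDl ipP) !ipDr (ipC ipP v u); ring. Qed.

Lemma sqnB u v : sqn (u - v) = sqn u - 2 * ip u v + sqn v.
Proof. by rewrite sqnD ipNr ipNl ipNr; ring. Qed.

Lemma sqnN u : sqn (- u) = sqn u.
Proof. by rewrite ipNl ipNr opprK. Qed.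

Lemma sqnZ a u : sqn (a *: u) = a ^+ 2 * sqn u.
Proof. by rewrite (ipZl ipP) ipZr; ring. Qed.

Lemma sqnD_le u v : sqn (u + v) <= 2 * sqn u + 2 * sqn v.
Proof. by have := ip_ge0 ipP (u - v); rewrite sqnB sqnD; move: (sqn u) (ip u v) (sqn v) => a b c; lra. Qed.

Lemma sqn_sum_le (I : finType) (F : I -> V) :
  sqn (\sum_i F i) <= #|I|%:R * \sum_i sqn (F i).
Proof.
pose s i := sqn (F i); rewrite -[leRHS]/(_ * \sum_i s i).
have -> : sqn (\sum_i F i) = \sum_i \sum_j ip (F i) (F j).
  by rewrite ip_suml; apply: eq_bigr => i _; rewrite ip_sumr.
apply: (@le_trans _ _ (\sum_i \sum_j (s i + s j) / 2)).
  apply: ler_sum => i _; apply: ler_sum => j _.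
  have := ip_ge0 ipP (F i - F j); rewrite sqnB /s.
  move: (sqn (F i)) (ip (F i) (F j)) (sqn (F j)) => a b c; lra.
have E : \sum_i \sum_(j : I) s i = #|I|%:R * \sum_i s i.
  rewrite mulr_sumr; apply: eq_bigr => i _.
  by rewrite sumr_const mulr_natl.
have E' : \sum_(i : I) \sum_j s j = #|I|%:R * \sum_i s i.
  by rewrite sumr_const mulr_natl.
under eq_bigr do rewrite -mulr_suml big_split /=.
rewrite -mulr_suml big_split /= E E'.
by move: (#|I|%:R * _) => a; lra.
Qed.

(** The form may be degenerate: this is also applied to the energy of an
    operator that is only positive semidefinite. *)
Lemma cauchy_schwarz u v : ip u v ^+ 2 <= sqn u * sqn v.
Proof.
have := ip_ge0 ipP (sqn v *: u - ip u v *: v).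
rewrite sqnB !sqnZ (ipZl ipP) ipZr.
have := ip_ge0 ipP v; rewrite le0r => /orP[/eqP v0 _|v0 h].
  rewrite v0 mulr0; have [->|uv0] := eqVneq (ip u v) 0; first by rewrite expr0n.
  have := ip_ge0 ipP (u - ((sqn u + 1) / (2 * ip u v)) *: v).
  rewrite sqnB sqnZ ipZr v0 mulr0 addr0.
  have -> : 2 * ((sqn u + 1) / (2 * ip u v) * ip u v) = sqn u + 1 by field.
  move: (sqn u) => a; lra.
rewrite -subr_ge0 -(pmulr_rge0 _ v0).
by apply: le_trans h _; rewrite le_eqVlt; apply/orP; left; apply/eqP; ring.
Qed.

End Inner.

Definition sum_ip (R : realType) (V : lmodType R) (ip : V -> V -> R)
  (I : finType) (f g : {ffun I -> V}) : R := \sum_i ip (f i) (g i).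

Lemma sum_ip_inner (R : realType) (V : lmodType R) (ip : V -> V -> R)
  (I : finType) : is_inner ip -> is_inner (@sum_ip R V ip I).
Proof.
move=> ipP; split => [u v w|a u v|u v|u].
- by rewrite -big_split; apply: eq_bigr => i _; rewrite ffunE (ipDl ipP).
- by rewrite mulr_sumr; apply: eq_bigr => i _; rewrite ffunE (ipZl ipP).
- by apply: eq_bigr => i _; apply: (ipC ipP).
- by apply: sumr_ge0 => i _; apply: (ip_ge0 ipP).
Qed.

Lemma mul_inner (R : realType) : is_inner (fun x y : R^o => x * y : R).
Proof.
split => [u v w|a u v|u v|u]; [exact: mulrDl | by rewrite -mulrA | exact: mulrC|].
exact: sqr_ge0.
Qed.

Lemma cauchy_schwarz_sum (R : realType) (I : finType) (f g : I -> R) :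
  (\sum_i f i * g i) ^+ 2 <= (\sum_i f i ^+ 2) * (\sum_i g i ^+ 2).
Proof.
have := cauchy_schwarz (@sum_ip_inner R R^o _ I (mul_inner R))
  [ffun i => f i] [ffun i => g i].
rewrite /sum_ip; under eq_bigr do rewrite !ffunE.
under [X in _ <= X * _ -> _]eq_bigr do rewrite !ffunE -expr2.
by under [X in _ <= _ * X -> _]eq_bigr do rewrite !ffunE -expr2.
Qed.

(** * Quadratic forms of matrices and gradient descent *)

Section QuadraticForm.
Variables (R : realType) (W : lmodType R) (ip : W -> W -> R).
Hypothesis ipP : is_inner ip.
Variables (V : finType) (B : V -> V -> R).
Hypothesis B_sym : forall v u, B v u = B u v.

Definition qform (A : V -> V -> R) (f : V -> W) : R :=
  \sum_v \sum_u A v u * ip (f v) (f u).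

Lemma form_le_frobenius (A : V -> V -> R) (f : V -> W) :
  qform A f ^+ 2 <= (\sum_v \sum_u A v u ^+ 2) * (\sum_v ip (f v) (f v)) ^+ 2.
Proof.
rewrite /qform !pair_bigA /=; apply: le_trans (cauchy_schwarz_sum _ _) _.
apply: ler_wpM2l; first by apply: sumr_ge0 => *; apply: sqr_ge0.
rewrite expr2 mulr_suml; under [leRHS]eq_bigr do rewrite mulr_sumr.
rewrite pair_bigA /=; apply: ler_sum => -[v u] _ /=.
exact: (cauchy_schwarz ipP).
Qed.

Lemma form_sqr_le m (f : V -> W) :
  qform (mxpow B m) f ^+ 2 <=
  qform (mxpow B (m + m)) f * \sum_v ip (f v) (f v).
Proof.
pose g := [ffun v => \sum_u mxpow B m v u *: f u].
have := cauchy_schwarz (sum_ip_inner V ipP) [ffun v => f v] g.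
rewrite /sum_ip; under eq_bigr do rewrite !ffunE (ip_sumr ipP).
under eq_bigr do under eq_bigr do rewrite (ipZr ipP).
rewrite -/(qform (mxpow B m) f) mulrC.
under [X in _ <= _ * X -> _]eq_bigr do rewrite !ffunE.
rewrite (_ : \sum_v ip (g v) (g v) = qform (mxpow B (m + m)) f) //.
rewrite /qform; under [RHS]eq_bigr do under eq_bigr do rewrite mxpowD mulr_suml.
under [RHS]eq_bigr do rewrite exchange_big.
rewrite [RHS]exchange_big; apply: eq_bigr => w _.
rewrite ffunE (ip_suml ipP); apply: eq_bigr => v _.
rewrite (ip_sumr ipP); apply: eq_bigr => u _.
by rewrite (ipZl ipP) (ipZr ipP) (mxpow_sym B_sym m w v) mulrA.
Qed.

Lemma form_le_trace_pow (theta : R) (j m : nat) (f : V -> W) : 0 <= theta ->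
  \sum_v mxpow B (m * 2 ^ j.+1) v v <= theta ^+ (m * 2 ^ j.+1) ->
  `|qform (mxpow B m) f| <= theta ^+ m * \sum_v ip (f v) (f v).
Proof.
move=> th0; have S0 : 0 <= \sum_v ip (f v) (f v).
  by apply: sumr_ge0 => v _; apply: (ip_ge0 ipP).
suff H : \sum_v mxpow B (m * 2 ^ j.+1) v v <= theta ^+ (m * 2 ^ j.+1) ->
    qform (mxpow B m) f ^+ 2 <= (theta ^+ m * \sum_v ip (f v) (f v)) ^+ 2.
  by move/H => h; rewrite -ler_sqr ?nnegrE ?mulr_ge0 ?exprn_ge0 // real_normK ?num_real.
elim: j m => [|j IH] m.
  rewrite expn1 muln2 -addnn (trace_double B_sym) => h.
  apply: le_trans (form_le_frobenius _ _) _.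
  by rewrite exprMn ler_wpM2r ?sqr_ge0 // expr2 -exprD.
rewrite expnS mulnA => /IH; rewrite muln2 -addnn => h.
apply: le_trans (form_sqr_le _ _) _; rewrite exprMn expr2 [in leRHS]expr2.
rewrite -exprD mulrA ler_wpM2r //.
apply: le_trans (ler_norm _) _.
by rewrite -ler_sqr ?nnegrE ?mulr_ge0 ?exprn_ge0 // real_normK ?num_real.
Qed.

(** Repeated squaring: by Cauchy-Schwarz the form of a power of [B] is controlled
    by the form of its square, and the last step uses the Frobenius norm, whose
    square is again a trace. *)
Lemma form_le_trace (theta : R) (j : nat) (f : V -> W) : 0 <= theta ->
  \sum_v mxpow B (2 ^ j.+1) v v <= theta ^+ (2 ^ j.+1) ->
  `|qform B f| <= theta * \sum_v ip (f v) (f v).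
Proof.
move=> th0; rewrite -[(2 ^ _)%N]mul1n => /(form_le_trace_pow f th0).
rewrite expr1; congr (`| _ | <= _); apply: eq_bigr => v _; apply: eq_bigr => u _.
congr (_ * _); rewrite /= (bigD1 u) //= eqxx mulr1.
by rewrite big1 ?addr0 // => w /negbTE ->; rewrite mulr0.
Qed.

End QuadraticForm.

Section SpectralGap.
Variables (R : realType) (V : lmodType R) (ip : V -> V -> R).
Hypothesis ipP : is_inner ip.
Variables (L : {linear V -> V}) (c M : R).
Local Notation sqn u := (ip u u).
Hypotheses (c_gt0 : 0 < c) (cM : c <= M).
Hypothesis L_sym : forall u v, ip (L u) v = ip u (L v).
Hypothesis L_ge0 : forall u, 0 <= ip (L u) u.
Hypothesis L_gap : forall u, c * ip (L u) u <= sqn (L u).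
Hypothesis L_bounded : forall u, sqn (L u) <= M * ip (L u) u.

Definition descent (u : V) : V := u - M^-1 *: L u.

Let M_gt0 : 0 < M. Proof. exact: lt_le_trans cM. Qed.

Lemma energy_inner : is_inner (fun u v => ip (L u) v).
Proof.
split => // [u v w|a u v|u v].
- by rewrite linearD (ipDl ipP).
- by rewrite linearZ (ipZl ipP).
- by rewrite L_sym (ipC ipP).
Qed.

(** The gap inequality only controls [L u]; by Cauchy-Schwarz for the energy
    form it passes to the energy of [L u], which is what a descent step
    gains. *)
Lemma energy_image_ge u : c * sqn (L u) <= ip (L (L u)) (L u).
Proof.
have [e0|e0] := eqVneq (sqn (L u)) 0; first by rewrite e0 mulr0.
have s0 : 0 < sqn (L u) by rewrite lt_def e0 (ip_ge0 ipP).
have := cauchy_schwarz energy_inner u (L u).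
have := L_gap u; have := L_ge0 u; have := L_ge0 (L u).
set s := sqn (L u) in s0 *; set b := ip (L (L u)) _; set a := ip (L u) u.
move=> b0 a0 cas h.
rewrite -(ler_pM2l s0); apply: (@le_trans _ _ (c * (a * b))).
  by rewrite mulrCA ler_wpM2l ?(ltW c_gt0) // -expr2.
by rewrite mulrA ler_wpM2r.
Qed.

(** One step costs [t ^ 2 |L L u| ^ 2 <= t <L L u, L u>] with [t = 1 / M] and gains
    [2 t <L L u, L u>], where [<L L u, L u> >= c |L u| ^ 2]. *)
Lemma sqn_L_descent u : sqn (L (descent u)) <= (1 - c / M) * sqn (L u).
Proof.
rewrite /descent linearB linearZ /= (sqnB ipP) (sqnZ ipP) (ipZr ipP).
rewrite (ipC ipP (L u) (L (L u))).
have h1 := energy_image_ge u; have h2 := L_bounded (L u).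
set a := ip (L (L u)) (L u) in h1 h2 *; set s := sqn (L u) in h1 *.
set b := sqn (L (L u)) in h2 *; set t := M^-1.
have t0 : 0 < t by rewrite invr_gt0.
have h3 : t ^+ 2 * b <= t * a.
  rewrite expr2 -mulrA ler_pM2l // mulrC ler_pdivrMr //.
  by rewrite mulrC.
have h4 : t * (c * s) <= t * a by rewrite ler_pM2l.
nra.
Qed.

Lemma sqn_L_iter_descent u j :
  sqn (L (iter j descent u)) <= (1 - c / M) ^+ j * sqn (L u).
Proof.
elim: j => [|j IH]; first by rewrite mul1r.
rewrite exprS -mulrA; apply: le_trans (sqn_L_descent _) _.
by rewrite ler_wpM2l // subr_ge0 ler_pdivrMr // mul1r.
Qed.

End SpectralGap.

(** * The real Hilbert space underlying a complex one *)

Section Realification.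
Local Open Scope complex_scope.
Variables (R : realType) (H : hilbertSpace R).

(** Restricting the scalars turns unitary operators and sums with real weights
    into maps of real modules, for which the theory of real inner products is
    enough. *)
Definition realify : Type := hilbert_sort H.
HB.instance Definition _ := GRing.Zmodule.copy realify (hilbert_sort H).

Definition real_scale (a : R) (u : realify) : realify :=
  a%:C *: (u : hilbert_sort H).

Fact real_scaleA a b v : real_scale a (real_scale b v) = real_scale (a * b) v.
Proof. by rewrite /real_scale scalerA rmorphM. Qed.

Fact real_scale1 : left_id 1 real_scale.
Proof. by move=> u; rewrite /real_scale rmorph1 scale1r. Qed.

Fact real_scaleDr : right_distributive real_scale +%R.
Proof. by move=> a u v; rewrite /real_scale scalerDr. Qed.

Fact real_scaleDl v : {morph real_scale^~ v : a b / a + b}.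
Proof. by move=> a b; rewrite /real_scale rmorphD scalerDl. Qed.

HB.instance Definition _ := GRing.Zmodule_isLmodule.Build R realify
  real_scaleA real_scale1 real_scaleDr real_scaleDl.

Definition re_inner (u v : realify) : R := complex.Re (inner H u v).

Lemma hilbert_normE (u : realify) :
  `|(u : hilbert_sort H)| = (Num.sqrt (re_inner u u))%:C.
Proof.
have nE : `|(u : hilbert_sort H)| = (complex.Re `|(u : hilbert_sort H)|)%:C.
  by rewrite RRe_real // normr_real.
have n0 : 0 <= complex.Re `|(u : hilbert_sort H)| by rewrite -ler0c -nE.
rewrite /re_inner inner_norm nE -rmorphXn /= sqrtr_sqr ger0_norm //.
Qed.

Lemma re_inner_inner : is_inner re_inner.
Proof.
split=> [u v w|a u v|u v|u].
- by rewrite /re_inner linearDl raddfD.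
- rewrite /re_inner -[a *: u]/(real_scale a u) /real_scale linearZl_LR /=.
  by case: (inner H u v) => x y /=; rewrite mul0r subr0.
- rewrite /re_inner hermC expr0 mul1r.
  have conjE z : complex.Re (Num.conj z) = complex.Re z :> R.
    by rewrite (_ : Num.conj z = conjc z) //; case: z.
  exact: conjE.
- rewrite /re_inner inner_norm hilbert_normE -rmorphXn /=.
  exact: sqr_ge0.
Qed.

Definition nrm (u : realify) : R := Num.sqrt (re_inner u u).

Lemma nrm_ge0 u : 0 <= nrm u. Proof. exact: sqrtr_ge0. Qed.

Lemma sqr_nrm u : nrm u ^+ 2 = re_inner u u.
Proof. by rewrite sqr_sqrtr // (ip_ge0 re_inner_inner). Qed.

Lemma nrmD u v : nrm (u + v) <= nrm u + nrm v.
Proof.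
have := @ler_normD _ (hilbert_sort H) u v.
by rewrite !hilbert_normE -rmorphD lecR. Qed.

Lemma nrmN u : nrm (- u) = nrm u.
Proof. by apply: complexI; rewrite -!hilbert_normE; apply: (@normrN _ (hilbert_sort H)). Qed.

Lemma nrm_eq0 u : nrm u = 0 -> u = 0.
Proof. by move=> u0; apply/eqP; rewrite -(@normr_eq0 _ (hilbert_sort H)) hilbert_normE -/(nrm u) u0. Qed.

Lemma geometric_limit (u : nat -> realify) (C rho : R) :
  0 <= C -> 0 <= rho < 1 -> (forall j, nrm (u j.+1 - u j) <= C * rho ^+ j) ->
  exists v, forall j, nrm (v - u j) <= C / (1 - rho) * rho ^+ j.
Proof.
move=> C0 /andP[rho0 rho1] du; have r1 : 0 < 1 - rho by rewrite subr_gt0.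
set K := C / (1 - rho); have K0 : 0 <= K by rewrite divr_ge0 // ltW.
have tail m j : nrm (u (j + m)%N - u j) <= K * rho ^+ j.
  have E : C = K * (1 - rho) by rewrite divfK // gt_eqF.
  apply: (@le_trans _ _ (K * rho ^+ j - K * rho ^+ (j + m))); last first.
    by rewrite gerBl mulr_ge0 // exprn_ge0.
  elim: m => [|m IH]; first by rewrite addn0 !subrr /nrm (ip0l re_inner_inner) sqrtr0.
  rewrite -[u _ - _](subrKA (u (j + m)%N)); apply: le_trans (nrmD _ _) _.
  rewrite addnS; apply: le_trans (lerD (du _) IH) _.
  by rewrite E exprS le_eqVlt; apply/orP; left; apply/eqP; ring.
have rho_lim : (fun j => K * rho ^+ j) @ \oo --> (0 : R).
  rewrite -(mulr0 K); apply: cvgMr.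
  by apply: cvg_expr; rewrite ger0_norm.
have cu : cvgn (u : nat -> hilbert_sort H).
  apply/cauchy_cvgP/cauchy_exP => e e0.
  have eR : e = (complex.Re e)%:C by rewrite RRe_real // gtr0_real.
  have Re0 : 0 < complex.Re e by move: e0; rewrite {1}eR ltcR.
  have /cvgrPdist_lt /(_ _ Re0)[N _ hN] := rho_lim.
  exists (u N); exists N => // j Nj; rewrite /= -ball_normE /=.
  rewrite distrC (hilbert_normE (u j - u N)) eR ltcR.
  have := hN N (leqnn N); rewrite /= sub0r normrN ger0_norm; last first.
    by rewrite mulr_ge0 // exprn_ge0.
  by apply: le_lt_trans; have := tail (j - N)%N N; rewrite subnKC.
exists (limn (u : nat -> hilbert_sort H)) => j.
apply/ler_addgt0Pr => e e0.
have e0' : 0 < e%:C by rewrite ltcR.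
have /cvgrPdist_lt /(_ _ e0')[N _ hN] := cu.
rewrite -(subrKA (u (j + N)%N)) addrC.
apply: le_trans (nrmD _ _) _; apply: lerD; first exact: tail.
apply: ltW; rewrite -ltcR -hilbert_normE; apply: hN => /=.
by rewrite leq_addl.
Qed.

End Realification.

(** * Quasirandom sets of triples *)

Section TripleSums.
Variables (X : finType).
Local Notation E := {ffun 'I_3 -> X}.

Lemma card_fiber2 (i j : 'I_3) (x y : X) : i != j ->
  (\sum_(e : E) (e i == x) * (e j == y) = #|X|)%N.
Proof.
move=> ij.
pose G (k : 'I_3) z : nat :=
  if k == i then (z == x) else if k == j then (z == y) else true.
transitivity (\sum_(e : E) \prod_k G k (e k))%N.
  apply: eq_bigr => e _; rewrite (bigD1 i) //= (bigD1 j) /=; last by rewrite eq_sym.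
  rewrite /G eqxx [j == i]eq_sym (negbTE ij) eqxx big1 ?muln1 // => k /andP[/negbTE-> /negbTE->].
  by [].
rewrite -(bigA_distr_bigA G) (bigD1 i) //= (bigD1 j) /=; last by rewrite eq_sym.
have one (z : X) : (\sum_(w : X) (w == z) = 1)%N.
  by rewrite (bigD1 z) //= eqxx big1 // => w /negbTE ->.
rewrite /G; under eq_bigr do rewrite eqxx.
under [X in (_ * (X * _))%N]eq_bigr do rewrite [j == i]eq_sym (negbTE ij) eqxx.
rewrite !one !mul1n.
rewrite (eq_bigr (fun=> #|X|)); last first.
  by move=> k /andP[/negbTE-> /negbTE->]; rewrite sum_nat_const muln1.
rewrite prod_nat_const (_ : #|_| = 1%N) ?expn1 //.
rewrite -sum1_card big_mkcond !big_ord_recl big_ord0.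
by case: i j ij {G} => [[|[|[|i]]] hi] [[|[|[|j]]] hj].
Qed.

Lemma sum_triple2 (U : nmodType) (F : X -> X -> U) (i j : 'I_3) : i != j ->
  \sum_(e : E) F (e i) (e j) = (\sum_x \sum_y F x y) *+ #|X|.
Proof.
move=> ij.
transitivity (\sum_(e : E) \sum_x \sum_y F x y *+ ((e i == x) * (e j == y))).
  apply: eq_bigr => e _; rewrite (bigD1 (e i)) //= (bigD1 (e j)) //= !eqxx /=.
  rewrite !big1 ?addr0 // => x; last by rewrite eq_sym => /negbTE ->.
  by rewrite eq_sym => /negbTE xe; rewrite big1 // => y _; rewrite xe.
rewrite exchange_big -sumrMnl; apply: eq_bigr => x _.
rewrite exchange_big -sumrMnl; apply: eq_bigr => y _.
by rewrite sumrMnr (card_fiber2 x y ij).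
Qed.

Lemma sum_triple1 (U : nmodType) (F : X -> U) (i : 'I_3) :
  \sum_(e : E) F (e i) = (\sum_x F x) *+ #|X| ^ 2.
Proof.
have ij : i != i + 1 by case: i => [[|[|[|]]]].
rewrite (sum_triple2 (fun x _ => F x) ij).
by under eq_bigr do rewrite sumr_const; rewrite sumrMnl -mulrnA mulnn.
Qed.

End TripleSums.

Section Link.
Variables (R : realType) (W : lmodType R) (ip : W -> W -> R).
Hypothesis ipP : is_inner ip.
Local Notation sqn u := (ip u u).
Variables (X : finType) (rels : {set {ffun 'I_3 -> X}}) (p eps : R).
Local Notation N := (#|X|%:R : R).
Local Notation d := (p * N ^+ 2).
Hypotheses (N_gt0 : 0 < N) (p_gt0 : 0 < p) (eps_gt0 : 0 < eps).

(** The set [rels] behaves like a random set of density [p]: the indicator of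
    [rels] may be replaced by [p] in these quadratic sums.  Functions supported
    on one coordinate give the degrees, and on two coordinates the spectral gap
    of a link. *)
Definition quasirandom : Prop := forall f : 'I_3 -> X -> W,
  `|\sum_(e : {ffun 'I_3 -> X}) ((e \in rels)%:R - p) * sqn (\sum_i f i (e i))|
  <= eps * d * \sum_i \sum_x sqn (f i x).

Hypothesis rels_qr : quasirandom.

Let sum_rels (h : {ffun 'I_3 -> X} -> R) :
  \sum_(e in rels) h e =
  \sum_e ((e \in rels)%:R - p) * h e + p * \sum_e h e.
Proof.
rewrite mulr_sumr -big_split big_mkcond; apply: eq_bigr => e _ /=.
by case: (e \in rels); rewrite /= ?mulr1n ?mulr0n; ring.
Qed.

Let fcases (i j k : 'I_3) (a b c : X -> W) (l : 'I_3) : X -> W :=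
  if l == i then a else if l == j then b else if l == k then c else fun=> 0.

Let sum_fcases (U : nmodType) (i j k : 'I_3) (a b c : X -> W)
    (h : 'I_3 -> (X -> W) -> U) :
  i != j -> i != k -> j != k ->
  \sum_l h l (fcases i j k a b c l) = h i a + h j b + h k c.
Proof.
move=> ij ik jk; rewrite (bigD1 i) //= (bigD1 j) /=; last by rewrite eq_sym.
rewrite (bigD1 k) /=; last by rewrite ![k == _]eq_sym ik jk.
rewrite big1 => [|l].
  rewrite /fcases !eqxx [j == i]eq_sym (negbTE ij) ![k == _]eq_sym.
  by rewrite (negbTE ik) (negbTE jk) addr0 addrA.
move=> h3; exfalso; move: ij ik jk h3.
case: i => [[|[|[|?]]] ?] //; case: j => [[|[|[|?]]] ?] //;
by case: k => [[|[|[|?]]] ?] //; case: l => [[|[|[|?]]] ?].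
Qed.

Let S (psi chi : X -> W) : R := \sum_x sqn (psi x) + \sum_x sqn (chi x).

Let qr3 (i j k : 'I_3) (a b c : X -> W) : i != j -> i != k -> j != k ->
  `|\sum_(e : {ffun 'I_3 -> X}) ((e \in rels)%:R - p) *
      sqn (a (e i) + b (e j) + c (e k))|
  <= eps * d * (\sum_x sqn (a x) + \sum_x sqn (b x) + \sum_x sqn (c x)).
Proof.
move=> ij ik jk; have := rels_qr (fcases i j k a b c).
rewrite (sum_fcases a b c (fun _ f => \sum_x sqn (f x)) ij ik jk).
under eq_bigr => e _ do rewrite (sum_fcases a b c (fun l f => f (e l)) ij ik jk).
by [].
Qed.

Lemma degree_le (i : 'I_3) (psi : X -> W) :
  \sum_(e in rels) sqn (psi (e i)) <= (1 + eps) * d * \sum_x sqn (psi x).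
Proof.
have [j [k [ij ik jk]]] : exists j k, [/\ i != j, i != k & j != k].
  by exists (i + 1), (i - 1); case: i => [[|[|[|i]]] hi].
have := qr3 psi (fun=> 0) (fun=> 0) ij ik jk.
under eq_bigr do rewrite !addr0.
rewrite sum_rels (sum_triple1 (fun x => sqn (psi x)) i) -[_ *+ _ ^ _]mulr_natl natrX.
have -> : \sum_(x : X) ip 0 0 = 0 by rewrite big1 // => x _; rewrite (ip0l ipP).
rewrite !addr0.
have arith a b : a <= eps * d * b -> a + p * (N ^+ 2 * b) <= (1 + eps) * d * b.
  by lra.
by move=> /ler_normlP[_]; apply: arith.
Qed.

Lemma degree_ge (i : 'I_3) (psi : X -> W) :
  (1 - eps) * d * \sum_x sqn (psi x) <= \sum_(e in rels) sqn (psi (e i)).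
Proof.
have [j [k [ij ik jk]]] : exists j k, [/\ i != j, i != k & j != k].
  by exists (i + 1), (i - 1); case: i => [[|[|[|i]]] hi].
have := qr3 psi (fun=> 0) (fun=> 0) ij ik jk.
under eq_bigr do rewrite !addr0.
rewrite sum_rels (sum_triple1 (fun x => sqn (psi x)) i) -[_ *+ _ ^ _]mulr_natl natrX.
have -> : \sum_(x : X) ip 0 0 = 0 by rewrite big1 // => x _; rewrite (ip0l ipP).
rewrite !addr0.
have arith a b : - a <= eps * d * b -> (1 - eps) * d * b <= a + p * (N ^+ 2 * b).
  by lra.
by move=> /ler_normlP[+ _]; apply: arith.
Qed.

(** The deviation of a sum over [rels] from its expected value. *)
Definition noise_sum (i j : 'I_3) (psi chi : X -> W) : W :=
  \sum_(e : {ffun 'I_3 -> X})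
     ((e \in rels)%:R - p) *: (psi (e i) + chi (e j)).

(** Quasirandomness is applied with the constant functions [c *: Z] and
    [- c *: Z] on the third coordinate, where [Z] is the deviation itself: the
    difference of the two sums is [4 * c * |Z| ^ 2]. *)
Lemma noise_mean_le (i j k : 'I_3) (psi chi : X -> W) :
  i != j -> i != k -> j != k ->
  sqn (noise_sum i j psi chi) <= eps ^+ 2 * d ^+ 2 * N * S psi chi.
Proof.
move=> ij ik jk; set Z := noise_sum i j psi chi.
set s := S psi chi; set z := sqn Z.
have d_gt0 : 0 < d by rewrite mulr_gt0 // exprn_gt0.
(* with this [c] the last term of [h3] is half of its left-hand side *)
pose c := (eps * d * N)^-1.
have c_gt0 : 0 < c by rewrite invr_gt0 !mulr_gt0.
have sum_cst : \sum_(x : X) sqn (c *: Z) = c ^+ 2 * N * z.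
  by rewrite sumr_const (sqnZ ipP) -/z -[LHS]mulr_natl; ring.
have sum_cstN : \sum_(x : X) sqn (- (c *: Z)) = c ^+ 2 * N * z.
  by rewrite -sum_cst; apply: eq_bigr => x _; rewrite (sqnN ipP).
have h1 := qr3 psi chi (fun=> c *: Z) ij ik jk.
have h2 := qr3 psi chi (fun=> - (c *: Z)) ij ik jk.
rewrite sum_cst in h1; rewrite sum_cstN in h2.
have h3 : 4 * c * z <= 2 * (eps * d * (s + c ^+ 2 * N * z)).
  have -> : 4 * c * z = \sum_(e : {ffun 'I_3 -> X})
      ((e \in rels)%:R - p) * sqn (psi (e i) + chi (e j) + c *: Z) -
    \sum_(e : {ffun 'I_3 -> X})
      ((e \in rels)%:R - p) * sqn (psi (e i) + chi (e j) - c *: Z).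
    rewrite -sumrB {1}/z {1}/Z /noise_sum (ip_suml ipP) mulr_sumr; apply: eq_bigr => e _.
    rewrite (sqnB ipP) (sqnD ipP _ (c *: Z)) (ipZr ipP) (ipZl ipP _ _ Z).
    by move: (ip _ Z) (sqn (_ + _)) (sqn (c *: Z)) => u v w; ring.
  have arith (t a b : R) : a <= t -> - t <= b -> a - b <= 2 * t by lra.
  move: h1 h2; rewrite !ler_norml => /andP[_ h1] /andP[h2 _].
  exact: arith h1 h2.
have cE : c * (eps * d * N) = 1 by rewrite mulVf // gt_eqF // !mulr_gt0.
have E1 : 2 * (eps * d * (s + c ^+ 2 * N * z)) = 2 * (eps * d * s) + 2 * c * z.
  by transitivity (2 * (eps * d * s) + 2 * c * z * (c * (eps * d * N)));
    [ring | rewrite cE mulr1].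
rewrite E1 in h3.
have h4 : c * z <= eps * d * s by lra.
rewrite -(ler_pM2l c_gt0); apply: le_trans h4 _.
rewrite le_eqVlt; apply/orP; left; apply/eqP.
transitivity (c * (eps * d * N) * (eps * d * s)); first by rewrite cE mul1r.
by ring.
Qed.

Definition link_sum (i j : 'I_3) (psi chi : X -> W) : W :=
  \sum_(e in rels) (psi (e i) + chi (e j)).

Lemma link_sumE (i j : 'I_3) (psi chi : X -> W) : i != j ->
  link_sum i j psi chi =
  d *: (\sum_x psi x + \sum_x chi x) + noise_sum i j psi chi.
Proof.
move=> ij; have <- : p *: \sum_(e : {ffun 'I_3 -> X}) (psi (e i) + chi (e j)) =
    d *: (\sum_x psi x + \sum_x chi x).
  rewrite big_split /= !sum_triple1 -mulrnDl -scaler_nat scalerA natrX.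
  by [].
rewrite scaler_sumr -big_split /link_sum big_mkcond; apply: eq_bigr => e _ /=.
rewrite -scalerDl addrCA subrr addr0; case: (e \in rels); rewrite ?scale1r ?scale0r //.
Qed.

(** On a complete bipartite graph the sum of [|psi x - chi y| ^ 2] is a sum of
    squared norms minus twice the inner product of the sums of [psi] and [chi],
    and the latter is at most a quarter of the squared norm of their total,
    which [link_sum] measures.  The graph of the pairs [(e i, e j)] satisfies
    the same up to [eps]. *)
Lemma link_gap (i j k : 'I_3) (psi chi : X -> W) :
  i != j -> i != k -> j != k -> 0 < 1 - eps - eps ^+ 2 ->
  (1 - eps - eps ^+ 2) / (1 + eps) *
    (\sum_(e in rels) sqn (psi (e i)) + \sum_(e in rels) sqn (chi (e j)))
  - (p * N ^+ 3)^-1 * sqn (link_sum i j psi chi)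
  <= \sum_(e in rels) sqn (psi (e i) - chi (e j)).
Proof.
move=> ij ik jk eps_small.
have d_gt0 : 0 < d by rewrite mulr_gt0 // exprn_gt0.
set V := link_sum i j psi chi; set s := S psi chi.
set a := \sum_x psi x; set b := \sum_x chi x.
have deg : (1 - eps - eps ^+ 2) / (1 + eps) *
    (\sum_(e in rels) sqn (psi (e i)) + \sum_(e in rels) sqn (chi (e j)))
    <= (1 - eps - eps ^+ 2) * d * s.
  have e1 : 0 < 1 + eps by rewrite addr_gt0.
  rewrite mulrAC ler_pdivrMr // -!mulrA ler_pM2l //.
  apply: le_trans (lerD (degree_le i psi) (degree_le j chi)) _.
  by rewrite /s /S le_eqVlt; apply/orP; left; apply/eqP; ring.
have low : (1 - eps) * d * s - 2 * (p * N * ip a b) <=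
    \sum_(e in rels) sqn (psi (e i) - chi (e j)).
  rewrite sum_rels.
  have := qr3 psi (fun x => - chi x) (fun=> 0) ij ik jk.
  under eq_bigr do rewrite addr0.
  have -> : \sum_(x : X) ip 0 0 = 0 by rewrite big1 // => x _; rewrite (ip0l ipP).
  have -> : \sum_x sqn (- chi x) = \sum_x sqn (chi x).
    by apply: eq_bigr => x _; rewrite (sqnN ipP).
  have -> : \sum_(e : {ffun 'I_3 -> X}) sqn (psi (e i) - chi (e j)) =
      N ^+ 2 * s - 2 * (N * ip a b).
    rewrite (sum_triple2 (fun x y => sqn (psi x - chi y)) ij) -[LHS]mulr_natl.
    under eq_bigr do under eq_bigr do rewrite (sqnB ipP).
    under eq_bigr do rewrite !big_split /= sumr_const sumrN -mulr_sumr.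
    rewrite !big_split /= sumrN -mulr_sumr sumr_const sumrMnl.
    have -> : \sum_x \sum_y ip (psi x) (chi y) = ip a b.
      rewrite (ip_suml ipP); apply: eq_bigr => x _.
      by rewrite (ip_sumr ipP).
    rewrite -[_ *+ #|X| - _]/(_ *+ #|X| - 2 * ip a b) /s /S.
    rewrite -!(mulr_natl (\sum__ _)).
    by ring.
  rewrite addr0 => /ler_normlP[].
  have arith A : - A <= eps * d * s -> A <= eps * d * s ->
    (1 - eps) * d * s - 2 * (p * N * ip a b) <=
    A + p * (N ^+ 2 * s - 2 * (N * ip a b)) by lra.
  exact: arith.
have cross : 2 * (p * N * ip a b) <=
    (p * N ^+ 3)^-1 * sqn V + eps ^+ 2 * d * s.
  have ab : 4 * ip a b <= sqn (a + b).
    have := ip_ge0 ipP (a - b); rewrite (sqnB ipP) (sqnD ipP).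
    by move: (sqn a) (ip a b) (sqn b) => x y z; lra.
  have dab : d ^+ 2 * sqn (a + b) <= 2 * sqn V + 2 * (eps ^+ 2 * d ^+ 2 * N * s).
    rewrite -(sqnZ ipP) (_ : d *: (a + b) = V - noise_sum i j psi chi); last first.
      by rewrite /V (link_sumE _ _ ij) addrK.
    apply: le_trans (sqnD_le ipP _ _) _; rewrite (sqnN ipP) lerD2l ler_pM2l //.
    exact: noise_mean_le ij ik jk.
  set K := (p * N ^+ 3)^-1.
  have Kd : K * (p * N ^+ 3) = 1 by rewrite mulVf // gt_eqF // mulr_gt0 // exprn_gt0.
  have K0 : 0 < K by rewrite invr_gt0 mulr_gt0 // exprn_gt0.
  clearbody K.
  have KV : K * (d ^+ 2 * sqn (a + b)) <=
      2 * (K * sqn V) + 2 * (K * (eps ^+ 2 * d ^+ 2 * N * s)).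
    by rewrite ![2 * (K * _)]mulrCA -mulrDr ler_pM2l.
  have e1 : K * (d ^+ 2 * sqn (a + b)) = p * N * sqn (a + b).
    by transitivity (K * (p * N ^+ 3) * (p * N * sqn (a + b)));
      [ring | rewrite Kd mul1r].
  have e2 : K * (eps ^+ 2 * d ^+ 2 * N * s) = eps ^+ 2 * d * s.
    by transitivity (K * (p * N ^+ 3) * (eps ^+ 2 * d * s));
      [ring | rewrite Kd mul1r].
  have pN : 0 < p * N by rewrite mulr_gt0.
  move: KV; rewrite e1 e2.
  have : p * N * (4 * ip a b) <= p * N * sqn (a + b) by rewrite ler_pM2l.
  by move: (sqn (a + b)) (ip a b) (K * sqn V) => x y z; lra.
have arith x y z u v : x <= (1 - eps - eps ^+ 2) * d * s ->
  (1 - eps) * d * s - y <= z -> y <= u + eps ^+ 2 * d * s -> x - u <= z by lra.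
exact: arith deg low cross.
Qed.

End Link.

(** * Garland's argument for a unitary representation *)

Section Action.
Variables (R : realType) (H : hilbertSpace R) (G : groupType).
Variable rho : unitary_rep G H.
Local Notation W := (realify H).
Local Notation ip := (@re_inner R H).

Definition act (g : G) (u : W) : W := rho g u.

Lemma actD g u v : act g (u + v) = act g u + act g v.
Proof. exact: (linearD (rho g)). Qed.

Lemma actB g u v : act g (u - v) = act g u - act g v.
Proof. exact: (linearB (rho g)). Qed.

Lemma actZ g a u : act g (a *: u) = a *: act g u.
Proof. exact: (linearZ_LR (rho g)). Qed.

Lemma act1 u : act 1%g u = u.
Proof. exact: rep_one. Qed.

Lemma actM g h u : act (g * h)%g u = act g (act h u).
Proof. exact: rep_mul. Qed.

Lemma actK g u : act g^-1%g (act g u) = u.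
Proof. by rewrite -actM mulVg act1. Qed.

Lemma actVK g u : act g (act g^-1%g u) = u.
Proof. by rewrite -actM mulgV act1. Qed.

Lemma act_isom g u v : ip (act g u) (act g v) = ip u v.
Proof. by rewrite /re_inner (rep_unitary rho). Qed.

Lemma act_adj g u v : ip (act g^-1%g u) v = ip u (act g v).
Proof. by rewrite -(act_isom g) actVK. Qed.

Lemma nrm_act g u : nrm (act g u) = nrm u.
Proof. by rewrite /nrm act_isom. Qed.

Section Garland.
Variables (X : finType) (rels : {set {ffun 'I_3 -> X}}) (p : R).
Variable g : 'I_3 -> X -> G.
Hypothesis g_rel : forall e, e \in rels -> forall i,
  (g (i - 1) (e (i - 1)) * g i (e i) * g (i + 1) (e (i + 1)))%g = 1%g.
Hypotheses (X_gt0 : (0 < #|X|)%N) (p_gt0 : 0 < p).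
Hypothesis rels_qr : quasirandom ip rels p 4^-1.
Implicit Types (u v : {ffun 'I_3 -> W}) (e : {ffun 'I_3 -> X}) (i : 'I_3).

Local Notation ip3 := (@sum_ip R W ip 'I_3).
Local Notation ipP := (@re_inner_inner R H).
Local Notation ip3P := (@sum_ip_inner R W ip 'I_3 ipP).

Definition grad u i e : W := u i - act (g i (e i)) (u (i + 1)).

Definition energy u v : R := \sum_i \sum_(e in rels) ip (grad u i e) (grad v i e).

(** Half the gradient of the energy, that is, the operator representing the form
    [energy]; see [energyE]. *)
Definition garland_op u : {ffun 'I_3 -> W} :=
  [ffun i => \sum_(e in rels)
    (grad u i e - act (g (i - 1) (e (i - 1)))^-1%g (grad u (i - 1) e))].

Lemma gradD a u v i e : grad (a *: u + v) i e = a *: grad u i e + grad v i e.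
Proof.
rewrite /grad !ffunE actD actZ scalerBr opprD.
exact: addrACA.
Qed.

Lemma garland_op_linear : linear garland_op.
Proof.
move=> a u v; apply/ffunP => i; rewrite !ffunE scaler_sumr -big_split.
apply: eq_bigr => e _; rewrite /= !gradD actD actZ opprD addrACA.
by rewrite -(scalerBr a (grad u i e)).
Qed.

HB.instance Definition _ :=
  GRing.isLinear.Build R {ffun 'I_3 -> W} {ffun 'I_3 -> W} _ garland_op
    garland_op_linear.

Lemma sum_shift (U : nmodType) (F : 'I_3 -> U) :
  \sum_i F (i + 1) = \sum_i F i.
Proof. by rewrite [RHS](reindex_inj (addIr 1)). Qed.

Lemma energyE u v : ip3 (garland_op u) v = energy u v.
Proof.
pose a i := \sum_(e in rels) ip (grad u i e) (v i).
pose b i := \sum_(e in rels) ip (grad u (i - 1) e) (act (g (i - 1) (e (i - 1))) (v i)).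
have -> : ip3 (garland_op u) v = \sum_i a i - \sum_i b i.
  rewrite -sumrB; apply: eq_bigr => i _.
  rewrite ffunE (ip_suml ipP) -sumrB; apply: eq_bigr => e _.
  by rewrite (ipDl ipP) (ipNl ipP) act_adj.
rewrite -(sum_shift b) -sumrB; apply: eq_bigr => i _.
rewrite /a /b addrK -sumrB; apply: eq_bigr => e _.
by rewrite -(ipNr ipP) -(ipDr ipP).
Qed.

Lemma energy_sym u v : ip3 (garland_op u) v = ip3 u (garland_op v).
Proof.
rewrite (ipC ip3P u) !energyE; apply: eq_bigr => i _; apply: eq_bigr => e _.
exact: (ipC ipP).
Qed.

Lemma energy_ge0 u : 0 <= ip3 (garland_op u) u.
Proof. by rewrite energyE; do 2 apply: sumr_ge0 => ? _; apply: (ip_ge0 ipP). Qed.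

Let shift_neq i : [/\ i - 1 != i, i - 1 != i + 1 & i != i + 1].
Proof. by case: i => [[|[|[|i]]] hi]. Qed.

(** Seen from the vertex [i], the sides [i - 1] and [i] of a triangle are
    functions [psi] and [chi] on the link, the opposite side has the norm of
    [psi - chi] by the relation, and the sum of [psi + chi] over the link is,
    up to sign, the [i]-th component of [garland_op u].  The constant [11 / 20]
    is the value of [link_gap] at [eps = 1 / 4]; what matters is that it exceeds
    [1 / 2]. *)
Lemma vertex_gap u i :
  11 / 20 * (\sum_(e in rels) ip (grad u (i - 1) e) (grad u (i - 1) e) +
             \sum_(e in rels) ip (grad u i e) (grad u i e))
  - (p * #|X|%:R ^+ 3)^-1 * ip (garland_op u i) (garland_op u i)
  <= \sum_(e in rels) ip (grad u (i + 1) e) (grad u (i + 1) e).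
Proof.
have [n1 n2 n3] := shift_neq i.
pose psi x := act (g (i - 1) x)^-1%g (u (i - 1)) - u i.
pose chi x := act (g i x) (u (i + 1)) - u i.
have := link_gap ipP _ p_gt0 _ rels_qr psi chi n1 n2 n3.
rewrite invr_gt0 ltr0n X_gt0 ltr0n => /(_ isT isT).
have k0 : 0 < 1 - 4^-1 - 4^-1 ^+ 2 :> R by lra.
have kE : (1 - 4^-1 - 4^-1 ^+ 2) / (1 + 4^-1) = 11 / 20 :> R by field.
move=> /(_ k0); rewrite kE.
have -> : link_sum rels (i - 1) i psi chi = - garland_op u i.
  rewrite ffunE -sumrN; apply: eq_bigr => e _; rewrite /psi /chi /grad subrK.
  by rewrite actB actK !opprB.
rewrite (sqnN ipP).
have -> : \sum_(e in rels) ip (psi (e (i - 1))) (psi (e (i - 1))) =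
    \sum_(e in rels) ip (grad u (i - 1) e) (grad u (i - 1) e).
  apply: eq_bigr => e _; rewrite -(act_isom (g (i - 1) (e (i - 1)))).
  by rewrite /psi actB actVK /grad subrK.
have -> : \sum_(e in rels) ip (chi (e i)) (chi (e i)) =
    \sum_(e in rels) ip (grad u i e) (grad u i e).
  apply: eq_bigr => e _; rewrite -(sqnN ipP).
  by rewrite /chi opprB.
have -> // : \sum_(e in rels) ip (psi (e (i - 1)) - chi (e i)) (psi (e (i - 1)) - chi (e i)) =
    \sum_(e in rels) ip (grad u (i + 1) e) (grad u (i + 1) e).
apply: eq_bigr => e /g_rel /(_ i) ge.
rewrite -[RHS](act_isom (g i (e i))) -[RHS](sqnN ipP).
have i2 : i + 1 + 1 = i - 1 by case: i {ge u psi chi n1 n2 n3} => [[|[|[|i]]] hi] //; apply/val_inj.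
rewrite /grad actB i2 opprB -actM /psi /chi.
have -> : (g i (e i) * g (i + 1) (e (i + 1)) = (g (i - 1) (e (i - 1)))^-1)%g.
  by apply: (@mulgI _ (g (i - 1) (e (i - 1)))); rewrite mulgV mulgA.
by rewrite opprB addrA subrK.
Qed.

Local Notation c := (p * #|X|%:R ^+ 3 / 10).
Local Notation M := (4 * #|{ffun 'I_3 -> X}|%:R + c).

Let c_gt0 : 0 < c.
Proof. by rewrite divr_gt0 // mulr_gt0 // exprn_gt0 // ltr0n. Qed.

(** In the sum of the three vertex inequalities each side of the triangles
    appears twice on the left with weight [11 / 20], hence in excess by
    [1 / 10]. *)
Lemma garland_gap u :
  c * ip3 (garland_op u) u <= ip3 (garland_op u) (garland_op u).
Proof.
pose D i := \sum_(e in rels) ip (grad u i e) (grad u i e).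
have QE : ip3 (garland_op u) u = \sum_i D i by rewrite energyE.
have : \sum_i (11 / 20 * (D (i - 1) + D i) - (p * #|X|%:R ^+ 3)^-1 *
   ip (garland_op u i) (garland_op u i)) <= \sum_i D (i + 1).
  by apply: ler_sum => i _; apply: vertex_gap.
rewrite sumrB -!mulr_sumr big_split /= (sum_shift D).
have -> : \sum_i D (i - 1) = \sum_i D i.
  by rewrite -(sum_shift (fun i => D (i - 1))); apply: eq_bigr => i _; rewrite addrK.
rewrite QE -[\sum_i ip _ _]/(ip3 (garland_op u) (garland_op u)).
have k0 : 0 < p * #|X|%:R ^+ 3 by rewrite mulr_gt0 // exprn_gt0 // ltr0n.
move: (\sum_i D i) (ip3 _ _) => q s; move: (p * _) k0 => k k0 h.
have {}h : q / 10 <= k^-1 * s by lra.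
have := ler_wpM2l (ltW k0) h; rewrite [leRHS]mulrA mulfV ?gt_eqF // mul1r.
by rewrite mulrA mulrAC.
Qed.

Lemma garland_bounded u :
  ip3 (garland_op u) (garland_op u) <= M * ip3 (garland_op u) u.
Proof.
rewrite mulrDl ler_wpDr ?(mulr_ge0 (ltW c_gt0)) ?energy_ge0 //.
rewrite [X in _ <= _ * X]energyE /energy.
pose D i := \sum_(e in rels) ip (grad u i e) (grad u i e).
have h i : ip (garland_op u i) (garland_op u i) <=
    #|{ffun 'I_3 -> X}|%:R * (2 * D i + 2 * D (i - 1)).
  rewrite ffunE big_mkcond; apply: le_trans (sqn_sum_le ipP _) _.
  apply: ler_wpM2l => //; rewrite /D !mulr_sumr -big_split [leRHS]big_mkcond.
  apply: ler_sum => e _; case: ifP => _; last by rewrite (ip0l ipP).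
  apply: le_trans (sqnD_le ipP _ _) _.
  by rewrite (sqnN ipP) act_isom.
apply: le_trans (ler_sum _ (fun i _ => h i)) _.
rewrite -mulr_sumr big_split /= -!mulr_sumr.
have -> : \sum_i D (i - 1) = \sum_i D i.
  by rewrite -(sum_shift (fun i => D (i - 1))); apply: eq_bigr => i _; rewrite addrK.
rewrite -[\sum_i \sum_(e in rels) _]/(\sum_i D i) le_eqVlt; apply/orP; left.
by apply/eqP; ring.
Qed.

(** The steps of the gradient descent form a geometric series, whose total length
    is proportional to the square root of the initial energy; along the descent
    the energy tends to [0], so it vanishes at the limit. *)
Lemma zero_energy_near : exists C : R, forall u, exists v : 'I_3 -> W,
  (forall i, nrm (v i - u i) <= C * Num.sqrt (energy u u)) /\
  (forall e i, e \in rels -> v i = act (g i (e i)) (v (i + 1))).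
Proof.
have cM : c <= M by rewrite lerDr mulr_ge0.
have M0 : 0 < M by apply: lt_le_trans cM.
pose r := Num.sqrt (1 - c / M).
have cM1 : 0 <= 1 - c / M by rewrite subr_ge0 ler_pdivrMr // mul1r.
have r01 : 0 <= r < 1.
  rewrite sqrtr_ge0 -sqrtr1 ltr_sqrt // gtrBl divr_gt0 //.
pose step := descent garland_op M.
exists (M^-1 * Num.sqrt M / (1 - r)) => u.
pose s := ip3 (garland_op u) (garland_op u).
have s_le : Num.sqrt s <= Num.sqrt M * Num.sqrt (energy u u).
  rewrite -sqrtrM ?(ltW M0) // ler_sqrt ?mulr_ge0 -?energyE ?energy_ge0 ?(ltW M0) //.
  exact: garland_bounded.
have Lr j : ip3 (garland_op (iter j step u)) (garland_op (iter j step u)) <=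
    (r ^+ j * Num.sqrt s) ^+ 2.
  rewrite exprMn sqr_sqrtr ?(ip_ge0 ip3P) // exprAC sqr_sqrtr //.
  exact: (sqn_L_iter_descent ip3P c_gt0 cM energy_sym energy_ge0 garland_gap
    garland_bounded).
have coord (f : {ffun 'I_3 -> W}) i : nrm (f i) <= Num.sqrt (ip3 f f).
  rewrite /nrm ler_sqrt ?(ip_ge0 ip3P) // /sum_ip (bigD1 i) //= lerDl.
  by apply: sumr_ge0 => *; apply: (ip_ge0 ipP).
have sqrt_le (x y : R) : 0 <= y -> x <= y ^+ 2 -> Num.sqrt x <= y.
  by move=> y0 /ler_wsqrtr; rewrite sqrtr_sqr ger0_norm.
have r0 : 0 <= r by case/andP: r01.
have stepE w i : step w i - w i = - (M^-1 *: garland_op w i).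
  by rewrite /step /descent !ffunE addrAC subrr add0r.
have dstep i j : nrm ((iter j.+1 step u) i - (iter j step u) i) <=
    M^-1 * Num.sqrt s * r ^+ j.
  rewrite iterS stepE nrmN.
  rewrite /nrm (sqnZ ipP) sqrtrM ?sqr_ge0 // sqrtr_sqr ger0_norm ?invr_ge0 ?(ltW M0) //.
  rewrite -[leRHS]mulrA ler_wpM2l ?invr_ge0 ?(ltW M0) // [leRHS]mulrC.
  apply: le_trans (coord _ i) _; apply: sqrt_le (Lr j).
  by rewrite mulr_ge0 // ?exprn_ge0 // sqrtr_ge0.
have C0 : 0 <= M^-1 * Num.sqrt s by rewrite mulr_ge0 ?invr_ge0 ?(ltW M0) ?sqrtr_ge0.
have /choice[v hv] : forall i, exists v : W, forall j,
    nrm (v - (iter j step u) i) <= M^-1 * Num.sqrt s / (1 - r) * r ^+ j.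
  by move=> i; apply: (geometric_limit (u := fun j => (iter j step u) i) C0 r01 (dstep i)).
have r1 : 0 < 1 - r by rewrite subr_gt0; case/andP: r01.
exists v; split=> [i|e i er].
  have := hv i 0%N; rewrite mulr1 => h; apply: le_trans h _.
  rewrite [leRHS]mulrAC ler_wpM2r ?invr_ge0 ?(ltW r1) //.
  by rewrite -[leRHS]mulrA ler_wpM2l // invr_ge0 ltW.
pose B := M^-1 * Num.sqrt s / (1 - r).
pose A := B + B + Num.sqrt (c^-1) * Num.sqrt s.
have small j : nrm (v i - act (g i (e i)) (v (i + 1))) <= A * r ^+ j.
  pose w := iter j step u.
  have -> : v i - act (g i (e i)) (v (i + 1)) =
      (v i - w i) + act (g i (e i)) (w (i + 1) - v (i + 1)) + grad w i e.
    by rewrite actB /grad addrAC !subrKA.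
  apply: le_trans (nrmD _ _) _; rewrite !mulrDl; apply: lerD.
    apply: le_trans (nrmD _ _) _; apply: lerD; first exact: hv.
    by rewrite nrm_act -nrmN opprB; apply: hv.
  apply: (@le_trans _ _ (Num.sqrt (energy w w))).
    rewrite /nrm ler_sqrt -?energyE ?energy_ge0 // energyE /energy (bigD1 i) //=.
    rewrite (bigD1 e) //= -addrA lerDl addr_ge0 //.
      by apply: sumr_ge0 => *; apply: (ip_ge0 ipP).
    by do 2 apply: sumr_ge0 => ? _; apply: (ip_ge0 ipP).
  rewrite -[leRHS]mulrA -energyE.
  apply: (@le_trans _ _ (Num.sqrt (c^-1 * ip3 (garland_op w) (garland_op w)))).
    rewrite ler_wsqrtr // mulrC ler_pdivlMr // mulrC; exact: garland_gap.
  rewrite sqrtrM ?invr_ge0 ?(ltW c_gt0) // ler_wpM2l ?sqrtr_ge0 //.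
  rewrite mulrC; apply: sqrt_le (Lr j).
  by rewrite mulr_ge0 // ?exprn_ge0 // sqrtr_ge0.
apply/eqP; rewrite -subr_eq0; apply/eqP/nrm_eq0/eqP.
rewrite eq_le nrm_ge0 andbT leNgt; apply/negP => n0.
have : (fun j => A * r ^+ j) @ \oo --> (0 : R).
  rewrite -(mulr0 A); apply: cvgMr; apply: cvg_expr.
  by rewrite ger0_norm //; case/andP: r01.
move=> /cvgrPdist_lt /(_ _ n0)[j _ /(_ j (leqnn j))] /=.
rewrite sub0r normrN ltNge => /negP; apply.
by apply: le_trans (ler_norm _); apply: small.
Qed.

End Garland.
End Action.

(** * Blocks: reduced words between two occurrences of a letter *)

Section Words.
Variables (n : nat) (a : letter n).
Implicit Types (s t : letter n) (w x : seq (letter n)).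
Local Notation nc := (@no_cancel n).

Lemma inv_letter_neq s : s != inv_letter s.
Proof. by case: s => i []; rewrite /inv_letter; apply/eqP; case. Qed.

Lemma no_cancelxx s : nc s s.
Proof. exact: inv_letter_neq. Qed.

Lemma no_cancel_sym s t : nc s t = nc t s.
Proof. by rewrite /no_cancel [t == _]eq_sym (can2_eq (@inv_letterK n) (@inv_letterK n)). Qed.

(** Between two occurrences of [a] such a word never cancels, so blocks can be
    concatenated freely with [a] as separator. *)
Definition a_block w : bool := path nc a (rcons w a).

Lemma path_block w x : path nc a (w ++ a :: x) = a_block w && path nc a x.
Proof. by rewrite -cat_rcons cat_path last_rcons. Qed.

Lemma path_nseq m x : path nc a (nseq m a ++ x) = path nc a x.
Proof. by elim: m => //= m ->; rewrite no_cancelxx. Qed.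

Definition relator_word (m : nat) x y z : seq (letter n) :=
  x ++ a :: (y ++ a :: (z ++ a :: nseq m a)).

Lemma relator_word_cyclically_reduced m x y z :
  a_block x -> a_block y -> a_block z ->
  cyclically_reduced (relator_word m x y z).
Proof.
move=> bx by_ bz; rewrite /cyclically_reduced -(rot_cycle (size x)).
rewrite rot_size_cat /= rcons_cat -catA /= path_block by_ /=.
by rewrite -catA /= path_block bz /= path_nseq.
Qed.

Variable l : nat.

Definition block : finType :=
  {w : l.-tuple (letter n) | a_block w}.

Definition block_word (x : block) : seq (letter n) := tval (val x).

Lemma block_word_inj : injective block_word.
Proof. by move=> x y /val_inj /val_inj. Qed.

Lemma block_wordP (x : block) : a_block (block_word x).
Proof. exact: (valP x). Qed.

Lemma size_block_word (x : block) : size (block_word x) = l.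
Proof. exact: size_tuple. Qed.

Lemma blockE w : size w = l -> a_block w -> exists x : block, block_word x = w.
Proof.
move=> /eqP sw bw; exists (exist _ (Tuple sw) bw : block).
by [].
Qed.

End Words.

Section BlockCount.
Variables (n : nat) (a : letter n).
Local Notation nc := (@no_cancel n).

Let count (l : nat) (s : letter n) : nat :=
  \sum_(w : l.-tuple (letter n)) path nc s (rcons w a).

Let countS l s : count l.+1 s = (\sum_(t | nc s t) count l t)%N.
Proof.
rewrite /count (reindex (fun p : letter n * l.-tuple (letter n) => cons_tuple p.1 p.2)).
  rewrite -(pair_bigA _ (fun t (w : l.-tuple (letter n)) =>
    path nc s (rcons (cons_tuple t w) a) : nat)) /= [RHS]big_mkcond.
  apply: eq_bigr => t _ /=; case: ifP => // _.
  by rewrite big1.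
exists (fun w => (thead w, behead_tuple w)) => [[t w] _|w _] /=.
  by congr pair; apply/val_inj.
by rewrite [RHS]tuple_eta; apply/val_inj.
Qed.

Lemma card_no_cancel s : #|[pred t | nc s t]| = (2 * n - 1)%N.
Proof.
have := cardC1 (inv_letter s); rewrite /letter card_prod card_ord card_bool mulnC subn1 => <-.
by apply: eq_card => t; rewrite !inE.
Qed.

Lemma exists_other_generator : (2 <= n)%N -> exists j : 'I_n, j != a.1.
Proof.
move=> n2; pose j := if a.1 == 0%N :> nat then 1%N else 0%N.
have jn : (j < n)%N by rewrite /j; case: ifP => // _; apply: ltnW.
exists (Ordinal jn); rewrite -val_eqE /= /j.
by case: (nat_of_ord a.1).
Qed.

Lemma card_block_ge l : (2 <= n)%N ->
  ((2 * n - 1) ^ l <= #|block a l.+1|)%N.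
Proof.
move=> n2.
have -> : #|block a l.+1| = count l.+1 a.
  rewrite card_sig -sum1_card big_mkcond; apply: eq_bigr => w _.
  by rewrite inE /a_block; case: path.
elim: l (X in count _ X) => [|l IH] s.
  rewrite countS expn0.
  have [t st ta] : exists2 t, nc s t & nc t a.
    have [j ja] := exists_other_generator n2.
    exists (j, if s.1 == j then s.2 else false).
      case: eqP => [<-|/eqP sj]; first by rewrite -surjective_pairing no_cancelxx.
      by apply/eqP => /(congr1 fst) /= /esym/eqP; rewrite (negbTE sj).
    by apply/eqP => /(congr1 fst) /= /esym/eqP; rewrite (negbTE ja).
  by rewrite (bigD1 t) //= {1}/count (bigD1 [tuple]) //= ta.
rewrite expnS countS -{1}(card_no_cancel s) -sum_nat_const.
by apply: leq_sum => t _; apply: IH.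
Qed.

End BlockCount.

(** * Words evaluated in a presented group *)

Section Evaluation.
Variables (n k : nat) (rels : {set cyc_word n k}).
Local Open Scope group_scope.
Local Open Scope quotient_scope.
Implicit Types (s : letter n) (w : seq (letter n)).

Definition free_letter s : free_group n := @FreeGroup n [:: s] isT.

Definition free_word w : free_group n :=
  foldr (fun s x => free_letter s * x) 1 w.

Lemma word_of_free_word w : free_word w = reduce w :> seq _.
Proof.
elim: w => //= s w IH.
rewrite -[LHS]/(push s (reduce (free_word w))) IH reduce_id //.
exact: reduce_reduced.
Qed.

Lemma free_word_reduced w (rw : reduced w) : free_word w = FreeGroup rw.
Proof. by apply: val_inj; apply: etrans (word_of_free_word _) _; rewrite reduce_id. Qed.

Local Notation Gamma := (presented_group rels).

Definition ev w : Gamma := \pi_Gamma (free_word w).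

Lemma ev_nil : ev [::] = 1.
Proof. by apply/pi1_eq; have [[]] := normal_closure_normal [set free_of_cyc w | w in [set` rels]]. Qed.

Lemma ev_cons s w : ev (s :: w) = ev [:: s] * ev w.
Proof. by rewrite /ev -piM /= mulg1. Qed.

Lemma ev_cat w w' : ev (w ++ w') = ev w * ev w'.
Proof.
elim: w => [|s w IH] /=; first by rewrite ev_nil mul1g.
by rewrite ev_cons IH mulgA -ev_cons.
Qed.

Lemma ev_inv s : ev [:: inv_letter s] = (ev [:: s])^-1.
Proof.
apply: (@mulgI _ (ev [:: s])); rewrite mulgV -ev_cons /ev.
rewrite (_ : free_word _ = 1) -/(ev [::]) ?ev_nil //.
apply: val_inj; apply: etrans (word_of_free_word _) _.
by rewrite /reduce /= eqxx.
Qed.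

Lemma ev_surj (x : Gamma) : exists w, x = ev w.
Proof.
exists (word_of (repr x)); rewrite -[LHS]reprK /ev; congr (\pi_Gamma _).
by case: (repr x) => w rw; rewrite (free_word_reduced rw).
Qed.

Lemma ev_relator (w : cyc_word n k) : w \in rels -> ev (tval (val w)) = 1.
Proof.
move=> wr; apply/pi1_eq.
rewrite (free_word_reduced (cyclically_reduced_reduced (valP w))).
by move=> N [_ AN]; apply: AN; exists w.
Qed.

Definition letter_gens : seq Gamma := [seq ev [:: s] | s <- enum {: letter n}].

Lemma letter_gens_generate : generated_subgroup [set` letter_gens] = setT.
Proof.
apply/seteqP; split=> // x _ N [[N1 NM _] NS].
have [w ->] := ev_surj x; elim: w => [|s w IH]; first by rewrite ev_nil.
rewrite ev_cons; apply: NM IH; apply: NS => /=.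
by apply: map_f; rewrite mem_enum.
Qed.

End Evaluation.

(** * From quasirandom relators to Property (T) *)

Section BlockRelators.
Variables (n k l m : nat) (a : letter n).
Hypothesis k_eq : k = (3 * l + 3 + m)%N.
Local Notation E := {ffun 'I_3 -> block a l}.
Implicit Types (e : E) (s : letter n) (w : seq (letter n)).

Definition block_relator_word e : seq (letter n) :=
  relator_word a m (block_word (e (-1))) (block_word (e 0)) (block_word (e 1)).

Fact size_block_relator e : size (block_relator_word e) == k.
Proof.
rewrite /block_relator_word /relator_word !size_cat /= !size_cat /= size_cat /=.
by rewrite size_nseq !size_block_word k_eq; apply/eqP; lia.
Qed.

Definition block_relator e : cyc_word n k :=
  exist _ (Tuple (size_block_relator e))
    (relator_word_cyclically_reduced m (block_wordP (e (-1)))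
       (block_wordP (e 0)) (block_wordP (e 1))).

Lemma block_relator_inj : injective block_relator.
Proof.
move=> e e' /(congr1 (fun w : cyc_word n k => tval (val w))) /= /eqP.
rewrite /block_relator_word /relator_word.
rewrite eqseq_cat ?size_block_word // => /andP[/eqP h1]; rewrite eqseq_cons => /andP[_].
rewrite eqseq_cat ?size_block_word // => /andP[/eqP h2]; rewrite eqseq_cons => /andP[_].
rewrite eqseq_cat ?size_block_word // => /andP[/eqP h3] _.
apply/ffunP => i; apply: block_word_inj.
have : [|| i == -1, i == 0 | i == 1] by case: i => [[|[|[|i]]] hi].
by case/or3P => /eqP ->.
Qed.

Variable rels : {set cyc_word n k}.
Definition block_rels : {set E} := [set e | block_relator e \in rels].
Local Notation Gamma := (presented_group rels).
Local Notation ev := (ev rels).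

(** The sides of the triangle of a relator; the tail [a ^ m], present only to
    reach the length [k], belongs to the third side. *)
Definition block_elt (i : 'I_3) (x : block a l) : Gamma :=
  ev (block_word x ++ a :: (if i == 1 then nseq m a else [::])).

Lemma block_elt_rel e : e \in block_rels -> forall i,
  (block_elt (i - 1) (e (i - 1)) * block_elt i (e i) *
   block_elt (i + 1) (e (i + 1)))%g = 1%g.
Proof.
rewrite inE => /ev_relator /= er.
set x := block_elt (-1) (e (-1)); set y := block_elt 0 (e 0).
set z := block_elt 1 (e 1).
have xyz : (x * y * z = 1)%g.
  rewrite -er /x /y /z /block_elt -!ev_cat /block_relator_word /relator_word.
  by congr (ev _); rewrite /= !cats1 -!catA !cat_rcons.
have yzx : (y * z * x = 1)%g.
  by apply: (@mulgI _ x); rewrite !mulgA xyz mul1g mulg1.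
have zxy : (z * x * y = 1)%g.
  by apply: (@mulgI _ y); rewrite !mulgA yzx mul1g mulg1.
move=> i; have : [|| i == -1, i == 0 | i == 1] by case: i => [[|[|[|i]]] hi].
case/or3P => /eqP ->.
- by rewrite (_ : -1 - 1 = 1) ?addNr //; apply/val_inj.
- by rewrite sub0r add0r.
- by rewrite subrr (_ : 1 + 1 = -1) //; apply/val_inj.
Qed.

Section FixedVector.
Variables (R : realType) (H : hilbertSpace R) (rho : unitary_rep Gamma H).
Local Notation W := (realify H).
Local Notation A := (act rho).
Hypotheses (n_ge2 : (2 <= n)%N) (l_ge2 : (2 <= l)%N).

Lemma block_path_ss s : s != inv_letter a ->
  a_block a (nseq (l - 2) a ++ [:: s; s]) /\ a_block a (nseq (l - 2) a ++ [:: a; s]).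
Proof.
move=> sa; have sa' : no_cancel s a.
  by rewrite no_cancel_sym.
have as' : no_cancel a s by [].
rewrite /a_block !rcons_cat !path_nseq /=.
by rewrite as' sa' !no_cancelxx.
Qed.

(** Comparing blocks that agree up to their last two letters [s t] shows that
    [s t] maps [w = A a v] to a vector [y] independent of [s] and [t].  All letters
    but the inverse of [a] then map [w] to one vector [w1] and [w1] to [y], and a
    letter [b] for which [b] and its inverse are both available gives [y = w].  So
    every letter exchanges [w] and [w1], and [w + w1] is invariant.  One cannot
    expect [w1 = w], since the words of even length may form a proper
    subgroup. *)
Lemma letters_swap (v v0 : W) :
  (forall x : block a l, v0 = A (ev (block_word x ++ [:: a])) v) ->
  exists w1 : W, forall s, A (ev [:: s]) (A (ev [:: a]) v) = w1 /\
    A (ev [:: s]) w1 = A (ev [:: a]) v.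
Proof.
move=> hv; set w := A (ev [:: a]) v; set w1 := A (ev [:: a]) w.
set c := ev (nseq (l - 2) a); set y := A c^-1%g v0.
have two s t : a_block a (nseq (l - 2) a ++ [:: s; t]) ->
    A (ev [:: s]) (A (ev [:: t]) w) = y.
  move=> bst; have sz : size (nseq (l - 2) a ++ [:: s; t]) = l.
    by rewrite size_cat size_nseq /= subnK.
  have [x xE] := blockE sz bst.
  rewrite /y (hv x) xE -catA ev_cat actM actK.
  by rewrite -[[:: s; t] ++ [:: a]]/([:: s] ++ [:: t] ++ [:: a]) !ev_cat !actM.
have aa : a != inv_letter a by apply: inv_letter_neq.
have yE : A (ev [:: a]) w1 = y by apply: two; case: (block_path_ss aa).
have pos s : s != inv_letter a -> A (ev [:: s]) w = w1 /\ A (ev [:: s]) w1 = y.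
  move=> /block_path_ss[ss as'].
  have sw : A (ev [:: s]) w = w1.
    by rewrite -[LHS](actK rho (ev [:: a])) two // -yE actK.
  by split=> //; rewrite -sw two.
have [j ja] := exists_other_generator a n_ge2.
have pj b : (j, b) != inv_letter a.
  by apply/eqP => /(congr1 fst) /= ja'; rewrite ja' eqxx in ja.
have yw : y = w.
  have [_ <-] := pos _ (pj true); have [<- _] := pos _ (pj false).
  by rewrite -[(j, true)]/(inv_letter (j, false)) ev_inv actK.
exists w1 => s; have [->|sa] := eqVneq s (inv_letter a); last first.
  by have [-> ->] := pos _ sa.
rewrite ev_inv; split; last by rewrite actK.
by rewrite -[in LHS]yw -yE actK.
Qed.

Lemma act_word_near (eta : R) (u : W) w : 0 <= eta ->
  (forall s, nrm (A (ev [:: s]) u - u) <= eta) ->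
  nrm (A (ev w) u - u) <= (size w)%:R * eta.
Proof.
move=> eta0 hu; elim: w => [|s w IH].
  by rewrite ev_nil act1 subrr /nrm (ip0l (@re_inner_inner _ _)) sqrtr0 mul0r.
rewrite ev_cons actM -[A _ (A _ u) - u](subrKA (A (ev [:: s]) u)) -actB.
apply: le_trans (nrmD _ _) _; rewrite nrm_act /= -[(size w).+1]addn1 natrD mulrDl.
by rewrite mul1r lerD.
Qed.

Lemma invariant_of_letters (u : W) :
  (forall s, A (ev [:: s]) u = u) -> forall x, A x u = u.
Proof.
move=> hu x; have [w ->] := ev_surj x.
elim: w => [|s w IH]; first by rewrite ev_nil act1.
by rewrite ev_cons actM IH hu.
Qed.

End FixedVector.

(** The invariant vector is [w + w1] as in [letters_swap], close to twice the
    almost invariant vector [u] and therefore nonzero. *)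
Lemma quasirandom_property_T (R : realType) (p : R) :
  (2 <= n)%N -> (2 <= l)%N -> 0 < p -> (0 < #|block a l|)%N ->
  (forall H : hilbertSpace R, quasirandom (@re_inner R H) block_rels p 4^-1) ->
  property_T R Gamma.
Proof.
move=> n2 l2 p0 X0 qr; exists (letter_gens rels); split.
  exact: letter_gens_generate.
move=> H rho almost.
have [C hC] := zero_energy_near rho block_elt_rel X0 p0 (qr H).
(* [bound] controls the energy of the constant triple [u, u, u] *)
pose bound e := \sum_(i : 'I_3) (size (block_word (e i) ++
  a :: (if i == 1 then nseq m a else [::])))%:R ^+ 2 : R.
pose B := `|C| * Num.sqrt (\sum_(e in block_rels) bound e).
have B0 : 0 <= B by rewrite mulr_ge0 // sqrtr_ge0.
pose eta := (2 * B + 3)^-1.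
have eta0 : 0 < eta by rewrite invr_gt0; lra.
have [u [u0 hu]] := almost _ eta0.
have nu0 : 0 < @nrm R H u.
  rewrite lt_def nrm_ge0 andbT; apply/eqP => /nrm_eq0 uE.
  by rewrite uE eqxx in u0.
have near_u s : nrm (act rho (ev [:: s]) u - u) <= eta * @nrm R H u.
  have /hu : ev [:: s] \in letter_gens rels by apply: map_f; rewrite mem_enum.
  by rewrite hilbert_normE (hilbert_normE u) -rmorphM ltcR => /ltW.
set eps := eta * @nrm R H u in near_u.
have eps0 : 0 <= eps by rewrite mulr_ge0 ?nrm_ge0 // ltW.
have [v [v_near v_fix]] := hC [ffun=> u].
have {}v_near i : nrm (v i - u) <= B * eps.
  have := v_near i; rewrite ffunE => h; apply: le_trans h _.
  apply: le_trans (ler_wpM2r (sqrtr_ge0 _) (ler_norm C)) _.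
  rewrite /B -mulrA ler_wpM2l //.
  rewrite -(ger0_norm eps0) -sqrtr_sqr -sqrtrM; last first.
    by apply: sumr_ge0 => e _; apply: sumr_ge0 => j _; apply: sqr_ge0.
  apply: ler_wsqrtr; rewrite /energy exchange_big mulr_suml.
  apply: ler_sum => e _; rewrite mulr_suml; apply: ler_sum => j _.
  rewrite /grad !ffunE -exprMn -sqr_nrm -nrmN opprB.
  rewrite ler_sqr ?nnegrE ?nrm_ge0 //; last exact: mulr_ge0 (ler0n _ _) eps0.
  exact: act_word_near.
have [|w1 swap] := @letters_swap R H rho n2 l2 (v 1) (v 0).
  move=> x; have [f fr fx] : exists2 f, f \in block_rels & f 0 = x.
    (* an indicator function shows that every block occurs in a relator *)
    pose psi y := if y == x then u else 0.
    have N0 : 0 < #|block a l|%:R :> R by rewrite ltr0n.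
    have := degree_ge (@re_inner_inner R H) (qr H) 0 psi.
    have -> : \sum_y re_inner (psi y) (psi y) = re_inner (H := H) u u.
      rewrite (bigD1 x) //= /psi eqxx big1 ?addr0 // => y /negbTE ->.
      by rewrite (ip0l (@re_inner_inner R H)).
    move=> deg; apply: contrapT => no.
    have zero : \sum_(f in block_rels) re_inner (psi (f 0)) (psi (f 0)) = 0.
      rewrite big1 // => f fr; rewrite /psi; case: eqP => fx.
        by case: no; exists f.
      by rewrite (ip0l (@re_inner_inner R H)).
    move: deg; rewrite zero leNgt => /negP; apply.
    rewrite !mulr_gt0 ?exprn_gt0 //; first by lra.
    by rewrite -(sqr_nrm (H := H)) exprn_gt0.
  by rewrite (v_fix f 0 fr) add0r fx.
set w := act rho (ev [:: a]) (v 1) in swap.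
have w_near : nrm (w - u) <= (B + 1) * eps.
  rewrite /w -[_ - u](subrKA (act rho (ev [:: a]) u)) -actB.
  apply: le_trans (nrmD _ _) _; rewrite nrm_act mulrDl mul1r.
  exact: lerD.
have w1_near : nrm (w1 - u) <= (B + 2) * eps.
  have [<- _] := swap a.
  rewrite -[_ - u](subrKA (act rho (ev [:: a]) u)) -actB.
  apply: le_trans (nrmD _ _) _; rewrite nrm_act.
  by apply: le_trans (lerD w_near (near_u _)) _; rewrite le_eqVlt; apply/orP; left; apply/eqP; ring.
exists (w + w1); split; last first.
  apply: invariant_of_letters => s; rewrite actD.
  by have [-> ->] := swap s; rewrite addrC.
apply/eqP => ww1.
have : 2 * @nrm R H u <= (2 * B + 3) * eps.
  have -> : 2 * @nrm R H u = nrm ((2 : R) *: (u : realify H)).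
    rewrite /nrm (sqnZ (@re_inner_inner R H)) sqrtrM ?sqr_ge0 //.
    by rewrite sqrtr_sqr ger0_norm.
  have -> : (2 : R) *: (u : realify H) = - (w - u) - (w1 - u).
    by rewrite !opprB addrACA -opprD ww1 subr0 scaler_nat mulr2n.
  apply: le_trans (nrmD _ _) _; rewrite !nrmN.
  apply: le_trans (lerD w_near w1_near) _.
  by rewrite le_eqVlt; apply/orP; left; apply/eqP; ring.
rewrite /eps mulrA mulfV ?mul1r; last by rewrite gt_eqF //; lra.
by rewrite leNgt => /negP; apply; move: (nrm _) nu0 => x x0; lra.
Qed.

End BlockRelators.

(** * A random set of block relators is quasirandom *)

Section RandomBlockRelators.
Variables (R : realType) (n k l m : nat) (a : letter n) (p : R).
Hypothesis k_eq : k = (3 * l + 3 + m)%N.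
Hypothesis p01 : 0 < p < 1.
Hypothesis X_gt0 : (0 < #|block a l|)%N.
Local Notation X := (block a l).
Local Notation E := {ffun 'I_3 -> X}.
Local Notation V := ('I_3 * X)%type.
Local Notation N := (#|block a l|%:R : R).
Local Notation d := (p * N ^+ 2).

Definition incident (e : E) (v : V) : bool := e v.1 == v.2.

(** The matrix of the relator [e] has rank one: its quadratic form at [f] is
    [|f_0(e_0) + f_1(e_1) + f_2(e_2)| ^ 2]. *)
Definition incidence (e : E) (v u : V) : R := (incident e v)%:R * (incident e u)%:R.

Definition block_noise (rels : {set cyc_word n k}) : V -> V -> R :=
  noise p (block_relator k_eq) incidence rels.

Lemma block_noise_sym rels v u : block_noise rels v u = block_noise rels u v.
Proof. by apply: eq_bigr => e _; rewrite /incidence [_%:R * _]mulrC. Qed.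

Lemma sum_incident (e : E) (F : V -> R) :
  \sum_v (incident e v)%:R * F v = \sum_i F (i, e i).
Proof.
rewrite (eq_bigr (fun v => (incident e (v.1, v.2))%:R * F (v.1, v.2))); last first.
  by case.
rewrite -(pair_bigA _ (fun i x => (incident e (i, x))%:R * F (i, x))) /=.
apply: eq_bigr => i _; rewrite (bigD1 (e i)) //= /incident /= eqxx mul1r.
by rewrite big1 ?addr0 // => x; rewrite eq_sym => /negbTE ->; rewrite mul0r.
Qed.

Lemma sum_incidence e v : \sum_u incidence e v u = 3 * (incident e v)%:R.
Proof.
rewrite /incidence -mulr_sumr mulrC; congr (_ * _).
have := sum_incident e (fun=> 1).
by under eq_bigr do rewrite mulr1; rewrite sumr_const card_ord => ->.
Qed.

Lemma sum_incidence_le e v : \sum_u incidence e v u <= 3.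
Proof. by rewrite sum_incidence; case: incident; rewrite ?mulr1 ?mulr0. Qed.

Lemma incidence_degree v : \sum_e \sum_u incidence e v u = 3 * N ^+ 2.
Proof.
under eq_bigr do rewrite sum_incidence.
rewrite -mulr_sumr; congr (_ * _).
rewrite (sum_triple1 (fun x : X => (x == v.2)%:R : R) v.1).
rewrite (bigD1 v.2) //= eqxx big1 ?addr0 => [|x /negbTE -> //].
by rewrite -natrX.
Qed.

Lemma form_block_noise (W : lmodType R) (ip : W -> W -> R) rels
    (f : 'I_3 -> X -> W) : is_inner ip ->
  qform ip (block_noise rels) (fun v => f v.1 v.2) =
  \sum_e ((e \in block_rels a k_eq rels)%:R - p) *
    ip (\sum_i f i (e i)) (\sum_i f i (e i)).
Proof.
move=> ipP; rewrite /qform /block_noise /noise.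
under eq_bigr do under eq_bigr do rewrite mulr_suml.
under eq_bigr do rewrite exchange_big.
rewrite exchange_big; apply: eq_bigr => e _ /=.
rewrite inE -/(dev p (block_relator k_eq e) rels) (ip_suml ipP).
rewrite -(sum_incident e (fun v => ip (f v.1 v.2) (\sum_i f i (e i)))) mulr_sumr.
apply: eq_bigr => v _; rewrite (ip_sumr ipP).
rewrite -(sum_incident e (fun u => ip (f v.1 v.2) (f u.1 u.2))) !mulr_sumr.
by apply: eq_bigr => u _; rewrite /incidence; ring.
Qed.

Lemma trace_quasirandom j rels (H : hilbertSpace R) :
  \sum_v mxpow (block_noise rels) (2 ^ j.+1) v v <= (4^-1 * d) ^+ (2 ^ j.+1) ->
  quasirandom (@re_inner R H) (block_rels a k_eq rels) p 4^-1.
Proof.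
move=> tr f; case/andP: p01 => p0 _.
have d0 : 0 <= 4^-1 * d by rewrite !mulr_ge0 ?exprn_ge0 // ltW.
have := form_le_trace (@re_inner_inner R H) (block_noise_sym rels)
  (fun v => f v.1 v.2) d0 tr.
rewrite (form_block_noise rels f (@re_inner_inner R H)).
by rewrite -(pair_bigA _ (fun i x => re_inner (f i x) (f i x))).
Qed.

(** Trace bound and Markov's inequality; the parameters [j] and [r] of the trace
    method are still free. *)
Lemma block_property_T_pr (j : nat) (r : R) :
  (2 <= n)%N -> (2 <= l)%N -> 1 <= r ->
  1 - 3 * N * (12 / r + 12 * r * (2 ^ j.+1)%:R / d) ^+ (2 ^ j.+1)
  <= random_group_pr n k p (property_T R).
Proof.
move=> n2 l2 r1; case/andP: (p01) => p0 p1.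
have p01' : 0 <= p <= 1 by rewrite !ltW.
have N0 : 0 < N by rewrite ltr0n.
have d0 : 0 < d by rewrite mulr_gt0 // exprn_gt0.
have r0 : 0 < r by apply: lt_le_trans r1.
set L := (2 ^ j.+1)%N.
pose F rels := \sum_v mxpow (block_noise rels) L v v.
have th0 : 0 < (4^-1 * d) ^+ L by rewrite exprn_gt0 // mulr_gt0.
have F0 rels : 0 <= F rels.
  rewrite /F /L expnS mul2n -addnn (trace_double (block_noise_sym rels)).
  by do 2 apply: sumr_ge0 => ? _; apply: sqr_ge0.
have FP rels : F rels <= (4^-1 * d) ^+ L -> property_T R (presented_group rels).
  move=> tr; apply: (quasirandom_property_T (k_eq := k_eq) n2 l2 p0 X_gt0) => H.
  exact: trace_quasirandom tr.
apply: le_trans (random_group_pr_ge p01' th0 F0 FP).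
rewrite lerD2l lerN2 ler_pdivrMr //.
have inc0 e v u : 0 <= incidence e v u by rewrite mulr_ge0.
have deg v : \sum_e \sum_u incidence e v u <= 3 * N ^+ 2.
  by rewrite incidence_degree.
have := expect_noise_trace_le p01' (@block_relator_inj n k l m a k_eq) inc0 L r1
  deg (ler0n R 3) sum_incidence_le.
move=> /le_trans; apply.
rewrite -[leRHS]mulrA -exprMn card_prod card_ord natrM.
rewrite le_eqVlt; apply/orP; left; apply/eqP; congr (_ * _ ^+ _).
by field; rewrite !gt_eqF.
Qed.

End RandomBlockRelators.

(** * Asymptotics *)

Lemma card_block_le n (a : letter n) l : (#|block a l| <= (2 * n) ^ l)%N.
Proof.
rewrite card_sig; apply: leq_trans (max_card _) _.
by rewrite card_tuple /letter card_prod card_ord card_bool mulnC.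
Qed.

(** With [r = k] and a power [L] between [k] and [2 * k], the base of the trace
    bound is at most [36 / k], and its [L]-th power beats the number of blocks,
    which is only exponential in [k]. *)
Lemma property_T_pr_ge (R : realType) (n k : nat) (p : R) :
  (2 <= n)%N -> 0 < p < 1 -> (144 * n + 20 <= k)%N ->
  (2 * n%:R - 1) ^+ 6 * k%:R ^+ 6 <= (2 * n%:R - 1) `^ (2 * k%:R / 3) * p ->
  1 - 3 * 2^-1 ^+ k <= random_group_pr n k p (property_T R).
Proof.
move=> n2 p01 kn kp; case/andP: (p01) => p0 p1.
set q : R := 2 * n%:R - 1 in kp *.
have qE : q = (2 * n - 1)%:R by rewrite natrB ?natrM //; lia.
have q1 : 1 <= q by rewrite qE ler1n; lia.
have q0 : 0 < q by apply: lt_le_trans q1.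
pose l := ((k - 3) %/ 3)%N; pose m := ((k - 3) %% 3)%N.
have k_eq : k = (3 * l + 3 + m)%N by rewrite /l /m; lia.
have m3 : (m < 3)%N by rewrite ltn_mod.
have n0 : (0 < n)%N by lia.
have l2 : (2 <= l)%N by lia.
have lk : (l <= k)%N by lia.
clearbody l m.
pose a : letter n := (Ordinal n0, false).
have Nge : q ^+ l.-1 <= #|block a l|%:R.
  rewrite qE -natrX ler_nat; have := card_block_ge a l.-1 n2.
  by rewrite prednK //; lia.
have N0 : (0 < #|block a l|)%N.
  by rewrite -(ltr0n R); apply: lt_le_trans Nge; rewrite exprn_gt0.
pose j := (up_log 2 k).-1.
have jE : j.+1 = up_log 2 k by rewrite prednK // up_log_gt0; lia.
have [kL Lk] : (k <= 2 ^ j.+1)%N /\ (2 ^ j.+1 <= 2 * k)%N.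
  have k2 : (1 < k)%N by lia.
  have /andP[h1 h2] := up_log_bounds (isT : 1 < 2)%N k2.
  by rewrite jE; split => //; rewrite -jE expnS leq_mul2l /= ltnW.
have k1 : 1 <= k%:R :> R by rewrite ler1n; lia.
have k0 : 0 < k%:R :> R by apply: lt_le_trans k1.
apply: le_trans (block_property_T_pr k_eq p01 N0 j n2 l2 k1).
set N : R := #|block a l|%:R in Nge *.
set L := (2 ^ j.+1)%N in kL Lk *; clearbody L.
rewrite lerD2l lerN2 -mulrA ler_pM2l //.
have d_ge : k%:R ^+ 6 <= p * N ^+ 2.
  rewrite -(ler_pM2l (exprn_gt0 6 q0)); apply: le_trans kp _.
  apply: (@le_trans _ _ (q ^+ (6 + 2 * l.-1) * p)).
    rewrite ler_pM2r // -powR_mulrn ?(ltW q0) // ler_powR //.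
    rewrite ler_pdivrMr // -!natrM ler_nat; lia.
  rewrite exprD -mulrA ler_pM2l ?exprn_gt0 // mulrC ler_pM2l //.
  by rewrite mulnC exprM ler_pXn2r ?nnegrE ?exprn_ge0 // ?(ltW q0) // /N.
have d0 : 0 < p * N ^+ 2 by apply: lt_le_trans d_ge; rewrite exprn_gt0.
set b : R := 12 / k%:R + _.
have b0 : 0 <= b.
  by rewrite addr_ge0 ?divr_ge0 ?mulr_ge0 // ?(ltW d0) // ltW.
have b_le : b <= (4 * n%:R)^-1.
  apply: (@le_trans _ _ (36 / k%:R)).
    rewrite (_ : 36 = 12 + 24 :> R); last by rewrite -natrD.
    rewrite mulrDl lerD2l ler_pdivrMr // [leRHS]mulrAC ler_pdivlMr //.
    apply: (@le_trans _ _ (24 * k%:R ^+ 3)).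
      rewrite (_ : 24 * k%:R ^+ 3 = 12 * k%:R * (2 * k%:R) * k%:R); last by ring.
      rewrite ler_pM2r // ler_pM2l ?mulr_gt0 // -natrM ler_nat.
      by [].
    rewrite ler_pM2l //; apply: le_trans d_ge.
    exact: ler_weXn2l.
  rewrite ler_pdivrMr // mulrC ler_pdivlMr ?mulr_gt0 ?ltr0n //.
  by rewrite -!natrM ler_nat; clear -kn; lia.
have n0' : 0 < n%:R :> R by rewrite ltr0n.
have NN : N <= (2 * n%:R) ^+ k.
  have -> : (2 * n%:R) ^+ k = ((2 * n) ^ k)%:R :> R.
    by rewrite (natrX _ (2 * n)%N) (natrM _ 2 n).
  rewrite ler_nat; apply: leq_trans (card_block_le a l) _.
  by apply: leq_pexp2l lk; rewrite muln_gt0.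
have c0 : 0 <= (4 * n%:R)^-1 :> R by rewrite invr_ge0 mulr_ge0.
have c1 : (4 * n%:R)^-1 <= 1 :> R.
  by rewrite invf_le1 ?mulr_gt0 // -natrM ler1n muln_gt0.
have bL : b ^+ L <= (4 * n%:R)^-1 ^+ L by apply: lerXn2r; rewrite ?nnegrE.
have bk : b ^+ L <= (4 * n%:R)^-1 ^+ k.
  by apply: le_trans bL _; apply: ler_wiXn2l.
have N_ge0 : 0 <= N by apply: ler0n.
clearbody b N.
have -> : 2^-1 ^+ k = (2 * n%:R) ^+ k * (4 * n%:R)^-1 ^+ k :> R.
  by rewrite -exprMn; congr (_ ^+ _); field; rewrite gt_eqF.
by apply: ler_pM; rewrite ?exprn_ge0.
Qed.

Theorem theorem6p2 (R : realType) (n : nat) (p : nat -> R) :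
  (2 <= n)%N ->
  (forall k, (3 <= k)%N -> 0 < p k < 1) ->
  is_Omega (fun k => (2 * n%:R - 1) `^ (2 * k%:R / 3) * p k)
           (fun k => k%:R ^+ 6) ->
  random_group_pr n k (p k) (property_T R) @[k --> \oo] --> (1 : R).
Proof.
move=> n2 p01 omega.
have q0 : 0 < 2 * n%:R - 1 :> R.
  have : 2 <= n%:R :> R by rewrite (ler_nat R 2).
  by lra.
have pow0 : (fun k => 3 * 2^-1 ^+ k : R) @ \oo --> (0 : R).
  rewrite -(mulr0 3); apply: cvgMr; apply: cvg_expr.
  by rewrite ger0_norm // invf_lt1 // ltr1n.
apply/cvgrPdist_le => e e0.
have q6 : 0 < ((2 * n%:R - 1) ^+ 6)^-1 :> R by rewrite invr_gt0 exprn_gt0.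
move/cvgrPdist_lt: omega => /(_ _ q6) omega.
move/cvgrPdist_lt: pow0 => /(_ _ e0) pow0.
near=> k.
have kn : (144 * n + 20 <= k)%N by near: k; exists (144 * n + 20)%N.
have omega_k : `|0 - k%:R ^+ 6 / ((2 * n%:R - 1) `^ (2 * k%:R / 3) * p k)| <
    ((2 * n%:R - 1) ^+ 6)^-1 by near: k; exact: omega.
have pow_k : `|0 - 3 * 2^-1 ^+ k| < e by near: k; exact: pow0.
have /andP[pk0 pk1] : 0 < p k < 1 by apply: p01; lia.
rewrite ger0_norm ?subr_ge0; last first.
  by apply: random_group_pr_le1; rewrite !ltW.
rewrite lerBlDl -lerBlDr; apply: le_trans (property_T_pr_ge n2 _ kn _); last 2 first.
- by rewrite pk0.
- move: omega_k; set f := _ * p k; have f0 : 0 < f by rewrite mulr_gt0 // powR_gt0.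
  rewrite sub0r normrN ger0_norm ?divr_ge0 ?exprn_ge0 // ?(ltW f0) //.
  by rewrite ltr_pdivrMr // ltr_pdivlMl ?exprn_gt0 // => /ltW.
rewrite lerD2l lerN2; move: pow_k.
by rewrite sub0r normrN => /ltW; apply: le_trans; apply: ler_norm.
Unshelve. all: by end_near. Qed.
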